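(* Let $p$ be a prime, $n\geq 2$, $1\leq k\leq n-1$, and $t\geq 1$ an integer with $t\leq \frac38p+1$. Let $\mathcal{B}$ be a minimal weighted $t$-fold $k$-blocking set of $\mathrm{PG}(n,p)$ with $|\mathcal{B}|\leq (t+\frac12)p^k-\frac12$. Then $\mathcal{B}$ is the weighted union of $t$ not necessarily distinct $k$-dimensional subspaces, i.e., there are $k$-dimensional subspaces $S_1,\dots,S_t$ (repetitions allowed) such that the weight of every point $P$ equals the number of indices $i$ with $P\in S_i$.
   Context: A weighted point set of $\mathrm{PG}(n,p)$ is a function $w$ from the points to the nonnegative integers; its size is $|\mathcal{B}|=\sum_P w(P)$, and for a subspace $U$, $|U\cap\mathcal{B}|=\sum_{P\in U}w(P)$. A weighted $t$-fold $k$-blocking set is a weighted point set such that every $(n-k)$-dimensional subspace $U$ satisfies $|U\cap\mathcal{B}|\geq t$. It is minimal if decreasing the weight of any point of positive weight yields a weighted point set that is no longer a weighted $t$-fold $k$-blocking set. Dimensions are projective. *)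

(* Defs.v *)
From HB Require Import structures.
From mathcomp Require Import all_boot all_order all_algebra.

Set Implicit Arguments.
Unset Strict Implicit.
Unset Printing Implicit Defensive.

Import Order.TTheory GRing.Theory Num.Theory.

Section FiniteSubspaces.

(* Gives access to the subtype structure of {vspace vT} over matrices. *)
Import VectorInternalTheory.

Variables (F : finFieldType) (vT : vectType F).

HB.instance Definition _ := [Countable of {vspace vT} by <:].
HB.instance Definition _ := [Finite of {vspace vT} by <:].

End FiniteSubspaces.

Section ProjectiveSpace.

Variables (F : finFieldType) (n : nat).

(* The points of PG(n, F) are the vector lines of F^(n+1). *)
Definition point := {U : {vspace 'rV[F]_n.+1} | \dim U == 1%N}.

(* Projective dimension is vector dimension minus one. *)
Definition has_pdim (d : nat) (U : {vspace 'rV[F]_n.+1}) := \dim U == d.+1.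

Definition on_subspace (U : {vspace 'rV[F]_n.+1}) (P : point) : bool :=
  (val P <= U)%VS.

Definition weighted_set := point -> nat.

Definition wsize (w : weighted_set) : nat := \sum_(P : point) w P.

Definition wcap (U : {vspace 'rV[F]_n.+1}) (w : weighted_set) : nat :=
  \sum_(P : point | on_subspace U P) w P.

Definition blocking_set (t k : nat) (w : weighted_set) : Prop :=
  forall U, has_pdim (n - k) U -> t <= wcap U w.

Definition minimal_blocking_set (t k : nat) (w : weighted_set) : Prop :=
  blocking_set t k w /\
  forall (P : point) (w' : weighted_set),
    w' P < w P -> (forall Q, Q != P -> w' Q = w Q) -> ~ blocking_set t k w'.

Definition weighted_union (t : nat) (S : 'I_t -> {vspace 'rV[F]_n.+1})
    (w : weighted_set) : Prop :=
  forall P : point, w P = #|[set i : 'I_t | on_subspace (S i) P]|.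

End ProjectiveSpace.

(* Main.v *)
(* In PG(k+1,p) the k-blocking condition concerns lines.  Over the field L with
   q = p^k elements these lines are the kernels of the linear functionals
   F_p^(k+2) -> L, so the points of B become hyperplanes of L^(k+2), at least t
   of them through every point.  Their product R therefore vanishes to order t
   everywhere, and R = sum_m r_m prod_j (X_j^q - X_j)^(m_j), with |m| = t and
   deg r_m <= deg R - tq, where r_m vanishes at every point on more than t of
   the hyperplanes.  Translating by X e, with e on exactly t hyperplanes, turns
   R into (X^q - X)^t f up to a constant at almost every point, and f divides
   each r_m f'.  The size bound keeps all degrees below q, so this divisibility
   holds identically, and minimality leaves only f' = 0: every line has t mod p
   points.

   Projecting from a point P of B and dividing by p the excess of each line
   through P over t gives a w(P)-fold blocking set one dimension lower; by
   induction it contains a (k-1)-subspace, which lifts to a k-subspace contained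
   in B.  Removing it and inducting on t finishes PG(k+1,p).

   In higher dimension, project from the points of weight zero.  The resulting
   decompositions agree, because every k-subspace S occurs with multiplicity
   min_S w.  Finally, minimality turns containment of the t subspaces in B into
   equality. *)

Require Import Defs.
From HB Require Import structures.
From mathcomp Require Import all_boot all_order all_algebra all_field.
From mathcomp Require Import mpoly lra zify.

Set Implicit Arguments.
Unset Strict Implicit.
Unset Printing Implicit Defensive.

Import Order.TTheory GRing.Theory Num.Theory.
Local Open Scope ring_scope.

(** * Polynomials vanishing to high order on a finite affine space *)

Section Multivariate.

Variable L : finFieldType.
Local Notation q := #|L|.

(** The congruence comes with a restriction: it compares a line with a second line that has exactly
    t points and shares no point of B with it. Much of the work in PG(k+1,p) is to supply this
    companion. Through a point of weight zero the lines average so close to t points that some have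
    exactly t, even outside a prescribed hyperplane of the quotient. This settles the lines with a
    point of weight zero and, for k > 1, also the others, by a skew choice. In a plane any two lines
    meet, and lines inside the support need a separate count. The constants: with q = p^k and d =
    deg f = |B| - t - tq, the size bound reads 2d + 2t + 1 <= q. The remainders that have to vanish
    have degree at most 2d + t, and the exceptional points lie on t hyperplanes through e, which
    costs another t. The same bound leaves B an excess over t k-subspaces of less than half a
    k-subspace, so the later comparisons of multiplicities are rounding arguments. *)

Lemma msizeM_bound (n a b : nat) (P Q : {mpoly L[n]}) :
  (msize P <= a.+1 -> msize Q <= b.+1 -> msize (P * Q) <= (a + b).+1)%N.
Proof.
have [->|P0] := eqVneq P 0; first by rewrite mul0r msize0.
have [->|Q0] := eqVneq Q 0; first by rewrite mulr0 msize0.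
rewrite msizeM //; move: (mmeasure _ P) (mmeasure _ Q) => x y; lia.
Qed.

Lemma poly_vanish (P : {poly L}) : (size P <= q)%N -> (forall x, P.[x] = 0) -> P = 0.
Proof.
move=> sP vP; apply/eqP; case: eqVneq => // P0.
have := max_poly_roots P0 (rs := enum L).
rewrite -cardE ltnNge sP => /(_ _ (enum_uniq _)); apply.
by apply/allP => x _; rewrite /root vP.
Qed.

Lemma mpoly_reduced_vanish (n : nat) (P : {mpoly L[n]}) :
  (forall m i, m \in msupp P -> (m i < q)%N) ->
  (forall v, P.@[v] = 0) -> P = 0.
Proof.
elim: n P => [|n IH] P red vP.
  have sP : (msize P <= 1)%N.
    rewrite msizeE; apply/bigmax_leqP_seq => m _ _.
    by rewrite mdegE big_ord0.
  have := vP (fun _ => 0); rewrite (msize1_polyC sP) mevalC => ->.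
  by rewrite mpolyC0.
pose ext (v : 'I_n -> L) (x : L) (i : 'I_n.+1) : L :=
  if unlift ord_max i is Some j then v j else x.
have extw v x (i : 'I_n) : ext v x (widen_ord (leqnSn n) i) = v i.
  rewrite /ext; have -> : widen_ord (leqnSn n) i = lift ord_max i.
    by apply/val_inj; rewrite /= /bump leqNgt ltn_ord.
  by rewrite liftK.
have extm v x : ext v x ord_max = x by rewrite /ext unlift_none.
pose low (m : 'X_{1..n.+1}) := [multinom m (widen_ord (leqnSn n) i) | i < n].
have coefQ k : (muni P)`_k =
   \sum_(m <- msupp P | m ord_max == k) P@_m *: 'X_[low m].
  rewrite muniE coef_sum [RHS]big_mkcond /=; apply: eq_bigr => m _.
  by rewrite coefZ coefXn eq_sym; case: eqP => _; rewrite ?mulr1 ?mulr0.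
have Q0 k : (muni P)`_k = 0.
  apply: IH => [m i|v].
    rewrite coefQ => /msupp_sum_le.
    case/flatten_mapP => /= u; rewrite mem_filter => /andP[uk up].
    by move/msuppZ_le; rewrite msuppX inE => /eqP ->; rewrite mnmE; apply: red.
  pose S := \poly_(j < q) ((muni P)`_j).@[v].
  have red' u : u \in msupp P -> (u ord_max < q)%N by exact: red.
  have S0 : S = 0.
    apply: poly_vanish => [|x]; first exact: size_poly.
    rewrite horner_poly -[RHS](vP (ext v x)) mevalE.
    under eq_bigr => j _ do rewrite coefQ raddf_sum mulr_suml big_mkcond /=.
    rewrite exchange_big /= big_seq [RHS]big_seq; apply: eq_bigr => m mP.
    rewrite (bigD1 (Ordinal (red' m mP))) //= eqxx big1 ?addr0.
      rewrite mevalZ mevalX -mulrA; congr (_ * _).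
      rewrite big_ord_recr /= extm; congr (_ * _).
      by apply: eq_bigr => i _; rewrite mnmE extw.
    by move=> j jm; rewrite ifN //; apply: contra jm => /eqP jm; apply/eqP/val_inj.
  have [kq|qk] := ltnP k q.
    by have := coef_poly q (fun j => ((muni P)`_j).@[v]) k; rewrite kq -/S S0 coef0.
  rewrite coefQ big_seq_cond big1 ?meval0 // => u /andP[/red' uk /eqP ku].
  by move: uk; rewrite ku ltnNge qk.
apply/mpolyP => m; rewrite mcoeff0.
have [mP|/memN_msupp_eq0 //] := boolP (m \in msupp P).
have := congr1 (mcoeff (low m)) (Q0 (m ord_max)).
rewrite coefQ raddf_sum /= mcoeff0 -big_filter (bigD1_seq m) ?filter_uniq //=.
  rewrite mcoeffZ mcoeffX eqxx mulr1 big_filter_cond big1 ?addr0 //.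
  move=> u /andP[/eqP um une]; rewrite mcoeffZ mcoeffX.
  case: eqP => [lowE|_]; last by rewrite mulr0.
  case/eqP: une; apply/mnmP => i.
  case: (unliftP ord_max i) => [j ->|->] //.
  have := congr1 (fun f : 'X_{1..n} => f j) lowE; rewrite !mnmE.
  have -> // : widen_ord (leqnSn n) j = lift ord_max j.
  by apply/val_inj; rewrite /= /bump leqNgt ltn_ord.
by rewrite mem_filter eqxx.
Qed.

Lemma mpoly_vanish (n : nat) (P : {mpoly L[n]}) :
  (msize P <= q)%N -> (forall v, P.@[v] = 0) -> P = 0.
Proof.
move=> sP; apply: mpoly_reduced_vanish => m i mP.
apply: leq_trans sP; apply: leq_ltn_trans (msize_mdeg_lt mP).
by rewrite mdegE (bigD1 i) //= leq_addr.
Qed.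

Section Ideal.

Variable n : nat.
Implicit Types (P : {mpoly L[n]}) (y z : 'I_n -> L) (m : 'X_{1..n}).

Definition frob (j : 'I_n) : {mpoly L[n]} := 'X_j ^+ q - 'X_j.

Lemma msizeD_bound D P Q : (msize P <= D -> msize Q <= D -> msize (P + Q) <= D)%N.
Proof. by move=> sP sQ; apply: leq_trans (msizeD_le _ _) _; rewrite geq_max sP. Qed.

Lemma msize_sum_bound D (I : Type) (r : seq I) (p : pred I) (F : I -> {mpoly L[n]}) :
  (forall i, p i -> (msize (F i) <= D)%N) -> (msize (\sum_(i <- r | p i) F i) <= D)%N.
Proof.
move=> sF; elim/big_ind: _ => //; first by rewrite msize0.
by move=> ? ?; apply: msizeD_bound.
Qed.

(** Replacing X_i^q by X_i in a monomial lowers its degree, so the reduction terminates; each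
    replacement puts into the quotient a monomial whose degree is smaller by q, hence the bound D -
    q. *)
Lemma reduce_mod_frob D P : (msize P <= D)%N ->
  exists2 rP : ('I_n -> {mpoly L[n]}) * {mpoly L[n]},
    P = \sum_j frob j * rP.1 j + rP.2 &
    (forall j, (msize (rP.1 j) <= D - q)%N) /\
    (forall m i, m \in msupp rP.2 -> (m i < q)%N).
Proof.
have q1 : (1 < q)%N := finNzRing_gt1 L.
pose red P := forall m i, m \in msupp P -> (m i < q)%N.
suff mono k m c : (mdeg m <= k)%N -> (mdeg m < D)%N ->
    exists2 rP : ('I_n -> {mpoly L[n]}) * {mpoly L[n]},
    c *: 'X_[m] = \sum_j frob j * rP.1 j + rP.2 &
    (forall j, (msize (rP.1 j) <= D - q)%N) /\ red rP.2.
  move=> sP; rewrite (mpolyE P) big_seq.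
  elim/big_ind: _ => [|A B [[r A0] -> [/= sr rA]] [[r' B0] -> [/= sr' rB]]|m mP].
  - exists (fun _ => 0, 0) => /=; first by rewrite big1 ?addr0 // => j _; rewrite mulr0.
    by split=> [j|m i]; rewrite ?msize0 // msupp0.
  - exists (fun j => r j + r' j, A0 + B0) => /=.
      rewrite addrACA -big_split /=; congr (_ + _).
      by apply: eq_bigr => j _; rewrite mulrDr.
    split=> [j|m i /msuppD_le]; first exact: msizeD_bound.
    by rewrite mem_cat => /orP[/rA|/rB].
  - apply: (mono _ _ _ (leqnn _)); apply: leq_trans sP; exact: msize_mdeg_lt.
elim: k m c => [|k IH] m c mk mD.
  exists (fun _ => 0, c *: 'X_[m]) => /=.
    by rewrite big1 ?add0r // => j _; rewrite mulr0.
  split=> [j|u i]; first by rewrite msize0.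
  move/msuppZ_le; rewrite msuppX inE => /eqP ->.
  move: mk; rewrite leqn0 mdeg_eq0 => /eqP ->; rewrite mnmE; exact: ltnW.
have [/existsP[i qi]|/existsPn small] := boolP [exists i, (q <= m i)%N]; last first.
  exists (fun _ => 0, c *: 'X_[m]) => /=.
    by rewrite big1 ?add0r // => j _; rewrite mulr0.
  split=> [j|u i]; first by rewrite msize0.
  by move/msuppZ_le; rewrite msuppX inE => /eqP ->; rewrite ltnNge small.
pose m0 := (m - U_(i) *+ q)%MM.
have Em : m = (m0 + U_(i) *+ q)%MM.
  apply/mnmP => j; rewrite mnmDE mnmBE mulmnE mnm1E.
  by case: (eqVneq i j) => [<-|_]; rewrite ?(mul1n, mul0n) ?subnK ?subn0 ?addn0.
have dm : mdeg m = (mdeg m0 + q)%N by rewrite {1}Em mdegD mdegMn mdeg1 mul1n.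
case: (IH (m0 + U_(i))%MM c).
- by rewrite mdegD mdeg1; lia.
- by rewrite mdegD mdeg1; lia.
move=> [r P0] /= E [sr rP0].
exists (fun j => (if j == i then c *: 'X_[m0] else 0) + r j, P0) => /=.
  under eq_bigr => j _ do rewrite mulrDr.
  rewrite big_split /= -addrA -E (bigD1 i) //= eqxx big1 ?addr0; last first.
    by move=> j /negbTE ->; rewrite mulr0.
  rewrite {1}Em !mpolyXD -mpolyXn /frob -!scalerAr -scalerDr; congr (_ *: _).
  by rewrite mulrBl mulrC (mulrC 'X_[U_(i)]) subrK.
split=> // j; apply: msizeD_bound => //; case: eqP => _; rewrite ?msize0 //.
apply: leq_trans (msizeZ_le _ _) _; by rewrite msizeX ltn_subRL addnC -dm.
Qed.

Lemma frob_eval j y : (frob j).@[y] = 0.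
Proof. by rewrite /frob mevalB rmorphXn /= mevalXU expf_card subrr. Qed.

Lemma nullstellensatz D P : (msize P <= D)%N -> (forall y, P.@[y] = 0) ->
  exists2 r : 'I_n -> {mpoly L[n]},
    P = \sum_j frob j * r j & forall j, (msize (r j) <= D - q)%N.
Proof.
move=> sP vP; have [[r P0] /= E [sr rP0]] := reduce_mod_frob sP.
exists r => //; rewrite E (mpoly_reduced_vanish rP0) ?addr0 // => y.
have := vP y; rewrite E mevalD raddf_sum big1 /= ?add0r // => j _.
by rewrite mevalM frob_eval mul0r.
Qed.

Definition frobm m : {mpoly L[n]} := mmap1 frob m.

(** Membership in the t-th power of the vanishing ideal of the whole affine space, with control of
    the degrees of the coefficients. The subtraction is truncated: for D at most t q all
    coefficients are zero. *)
Definition frob_power (t D : nat) P := exists2 r : 'X_{1..n} -> {mpoly L[n]},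
  P = \sum_(m : 'X_{1..n < t.+1} | mdeg m == t) frobm m * r m &
  forall m, (msize (r m) <= D - t * q)%N.

Lemma frobmD m1 m2 : frobm (m1 + m2) = frobm m1 * frobm m2.
Proof. by apply: commr_mmap1_M => i x; apply: mulrC. Qed.

Lemma frobm1 j : frobm U_(j) = frob j.
Proof. exact: mmap1U. Qed.

Lemma frob_power0 D P : (msize P <= D)%N -> frob_power 0 D P.
Proof.
move=> sP; exists (fun=> P) => [|m]; last by rewrite mul0n subn0.
have H : (mdeg (0%MM : 'X_{1..n}) < 1)%N by rewrite mdeg0.
rewrite (bigD1 (BMultinom H)) /= ?mdeg_eq0 // big1 ?addr0.
  by rewrite /frobm mmap11 mul1r.
by move=> m /andP[]; rewrite mdeg_eq0 => /eqP m0 /eqP[]; exact/val_inj.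
Qed.

Lemma frob_power_sum t D (I : Type) (r : seq I) (p : pred I) (F : I -> {mpoly L[n]}) :
  (forall i, p i -> frob_power t D (F i)) -> frob_power t D (\sum_(i <- r | p i) F i).
Proof.
move=> H; elim/big_ind: _ => //.
- exists (fun _ => 0) => [|m]; last by rewrite msize0.
  by rewrite big1 // => m _; rewrite mulr0.
- move=> A B [a -> sa] [b -> sb]; exists (fun m => a m + b m) => [|m].
    by rewrite -big_split /=; apply: eq_bigr => m _; rewrite mulrDr.
  exact: msizeD_bound.
Qed.

Lemma frob_power_mono t D m P : mdeg m = t -> (msize P <= D - t * q)%N ->
  frob_power t D (frobm m * P).
Proof.
move=> dm sP; exists (fun u => if u == m then P else 0) => [|u]; last first.
  by case: eqP; rewrite ?msize0.
have mt : (mdeg m < t.+1)%N by rewrite dm.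
rewrite (bigD1 (BMultinom mt)) /= ?dm ?eqxx // big1 ?addr0 //.
by move=> u /andP[_ ne]; rewrite ifN ?mulr0.
Qed.

(** Restriction to the line y + X z: vanishing of P to order t at y becomes divisibility by X^t for
    all z. *)
Definition line y z P : {poly L} := mmap polyC (fun j => (y j)%:P + z j *: 'X) P.
HB.instance Definition _ y z := GRing.RMorphism.copy (line y z)
  (mmap polyC (fun j => (y j)%:P + z j *: 'X)).

Lemma line_at0 y z P : (line y z P).[0] = P.@[y].
Proof.
rewrite /line /mmap mevalE horner_sum; apply: eq_bigr => m _.
rewrite hornerM hornerC horner_prod; congr (_ * _); apply: eq_bigr => j _.
by rewrite horner_exp !hornerE.
Qed.

(** The q-th power is additive and fixes L, so (y + z X)^q = y + z X^q and the constant terms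
    cancel. *)
Lemma line_frob y z j : line y z (frob j) = z j *: ('X^q - 'X).
Proof.
have lX : line y z 'X_j = (y j)%:P + z j *: 'X by rewrite /line mmapX mmap1U.
rewrite /frob rmorphB rmorphXn /= lX.
have [p pr_p chp] := finPcharP L; have chP : p \in [pchar {poly L}] by rewrite pchar_poly.
have [k Ek] : exists k, q = (p ^ k)%N by exists (logn p q); exact: card_pprimeChar.
have addq (a b : {poly L}) : (a + b) ^+ q = a ^+ q + b ^+ q.
  rewrite Ek; elim: (k) => [|h IH]; first by rewrite expn0 !expr1.
  by rewrite expnSr !exprM IH; apply: (pFrobenius_autD_comm chP); apply: mulrC.
rewrite addq exprZn -rmorphXn /= !expf_card.
by rewrite opprD addrACA subrr add0r scalerBr.
Qed.

Lemma line_frobm y z m : line y z (frobm m) =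
  (\prod_j z j ^+ m j) *: ('X^q - 'X) ^+ mdeg m.
Proof.
rewrite /frobm /mmap1 rmorph_prod /= mdegE -prodrXr /= -scaler_prod.
by apply: eq_bigr => j _; rewrite rmorphXn /= line_frob exprZn.
Qed.

(* On the line y + X z the polynomial X_j^q - X_j becomes z_j (X^q - X), which
   has a simple root at 0, so order above t at y kills the degree-t form in z. *)
Lemma leading_form_vanish (t : nat) (r : 'X_{1..n} -> {mpoly L[n]}) P y :
  P = \sum_(m : 'X_{1..n < t.+1} | mdeg m == t) frobm m * r m ->
  (forall z, 'X^(t.+1) %| line y z P) ->
  forall z, \sum_(m : 'X_{1..n < t.+1} | mdeg m == t) (r m).@[y] * \prod_j z j ^+ m j = 0.
Proof.
move=> E dv z; have q1 : (1 < q)%N := finNzRing_gt1 L.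
have lE : line y z P = 'X^t * (('X^(q.-1) - 1) ^+ t *
    \sum_(m : 'X_{1..n < t.+1} | mdeg m == t) (\prod_j z j ^+ m j) *: line y z (r m)).
  rewrite E raddf_sum mulrA -exprMn mulrBr mulr1 -exprS prednK ?(ltnW q1) //.
  rewrite mulr_sumr; apply: eq_bigr => m /eqP dm.
  by rewrite /= rmorphM /= line_frobm dm -scalerAl scalerAr.
have := dv z; rewrite lE exprSr dvdp_mul2l ?monic_neq0 ?monicXn //.
rewrite -['X]subr0 dvdp_XsubCl /root hornerM horner_exp !hornerE /=.
rewrite oppr0 expr0n -subn1 subn_eq0 leqNgt q1 /= add0r mulf_eq0 expf_eq0.
rewrite oppr_eq0 oner_eq0 andbF /=.
move/eqP => S0; rewrite -[RHS]S0 horner_sum; apply: eq_bigr => m _.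
by rewrite hornerZ line_at0 mulrC.
Qed.

(** The leading form, read as a polynomial in z, vanishes everywhere and has degree t < q; so it is
    the zero polynomial, and its coefficients are the values of the r m at y. *)
Lemma frob_coef_vanish (t : nat) (r : 'X_{1..n} -> {mpoly L[n]}) P y :
  (t < q)%N ->
  P = \sum_(m : 'X_{1..n < t.+1} | mdeg m == t) frobm m * r m ->
  (forall z, 'X^(t.+1) %| line y z P) ->
  forall m, mdeg m = t -> (r m).@[y] = 0.
Proof.
move=> tq E dv m dm.
pose G : {mpoly L[n]} := \sum_(u : 'X_{1..n < t.+1} | mdeg u == t) (r u).@[y] *: 'X_[u].
have G0 : G = 0.
  apply: mpoly_vanish => [|z].
    apply: msize_sum_bound => u /eqP du.
    by apply: leq_trans (msizeZ_le _ _) _; rewrite msizeX du.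
  rewrite -[RHS](leading_form_vanish E dv z) raddf_sum /=; apply: eq_bigr => u _.
  by rewrite mevalZ mevalX.
have mt : (mdeg m < t.+1)%N by rewrite dm.
have := congr1 (mcoeff m) G0; rewrite raddf_sum mcoeff0 (bigD1 (BMultinom mt)) /= ?dm //.
rewrite mcoeffZ mcoeffX eqxx mulr1 big1 ?addr0 // => u /andP[_ ne].
rewrite mcoeffZ mcoeffX; case: eqP => [um|]; last by rewrite mulr0.
by case/eqP: ne; apply/val_inj.
Qed.

(** Each further order of vanishing makes all current coefficients vanish at every point, and
    [nullstellensatz] then extracts one more generator from each of them at the cost of q in
    degree. *)
Lemma vanish_frob_power (t D : nat) P : (t <= q)%N -> (msize P <= D)%N ->
  (forall y z, 'X^t %| line y z P) -> frob_power t D P.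
Proof.
move=> tq sP; elim: t tq => [|t IH] tq dv; first exact: frob_power0.
have [|r E sr] := IH (ltnW tq).
  by move=> y z; apply: dvdp_trans (dv y z); rewrite exprS dvdp_mull.
rewrite E; apply: frob_power_sum => m /eqP dm.
have [y|r' -> sr'] := nullstellensatz (sr m).
  exact: (frob_coef_vanish tq E (dv y)).
rewrite mulr_sumr; apply: frob_power_sum => j _.
rewrite mulrA -frobm1 -frobmD; apply: frob_power_mono.
  by rewrite mdegD mdeg1 dm addn1.
by rewrite mulSn addnC subnDA.
Qed.

End Ideal.

End Multivariate.

(** * Multisets as sequences, and polynomials that split into linear factors *)

Lemma count_flatten_nseq (T : finType) (g : T -> nat) (c : T) :
  count_mem c (flatten [seq nseq (g a) a | a <- enum T]) = g c.
Proof.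
rewrite count_flatten -map_comp sumnE big_map big_enum /= (bigD1 c) //=.
rewrite count_nseq /= eqxx mul1n big1 ?addn0 // => a /negbTE ac.
by rewrite count_nseq /= ac.
Qed.

Lemma prod_flatten_nseq (R : comPzRingType) (T : finType) (g : T -> nat) (F : T -> R) :
  \prod_(a <- flatten [seq nseq (g a) a | a <- enum T]) F a = \prod_a F a ^+ g a.
Proof.
rewrite big_flatten big_map big_enum /=; apply: eq_bigr => a _.
by rewrite big_nseq iter_mulr mulr1.
Qed.

(** Write the product as (X - c)^W g with g(c) nonzero. Cancelling (X - c)^(W-1) from the derivative
    and evaluating at c leaves W g(c) = 0. *)
Lemma deriv_prod_XsubC0 (L : fieldType) (p : nat) (l : seq L) (c : L) :
  p \in [pchar L] -> (\prod_(a <- l) ('X - a%:P))^`() = 0 -> (p %| count_mem c l)%N.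
Proof.
move=> chp; set W := count_mem c l.
pose g : {poly L} := \prod_(a <- l | a != c) ('X - a%:P).
have -> : \prod_(a <- l) ('X - a%:P) = ('X - c%:P) ^+ W * g.
  rewrite (bigID (pred1 c)) /=; congr (_ * _).
  rewrite (eq_bigr (fun=> 'X - c%:P)) => [|a /eqP -> //].
  by rewrite big_const_seq iter_mulr mulr1.
case: W => [|W]; first by rewrite dvdn0.
rewrite derivM deriv_exp /= derivXsubC mul1r.
move=> E; rewrite (dvdn_pcharf chp).
have : ('X - c%:P) ^+ W * (W.+1%:R *: g + ('X - c%:P) * g^`()) = 0.
  by rewrite -[RHS]E mulrDr mulrA -exprSr -scalerAr scaler_nat mulrnAl.
move/eqP; rewrite mulf_eq0 expf_eq0 polyXsubC_eq0 andbF /= => /eqP/(congr1 (fun h => h.[c])).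
rewrite hornerD hornerZ hornerM hornerXsubC subrr mul0r addr0 horner0 => /eqP.
rewrite mulf_eq0 => /orP[//|]; rewrite horner_prod prodf_seq_eq0 => /hasP[a _].
by rewrite hornerXsubC subr_eq0 eq_sym => /andP[/negbTE ->].
Qed.

(** The logarithmic derivative of a split polynomial has only simple poles, whatever the
    multiplicities of the roots, so simple zeros of g at the roots already clear them. *)
Lemma split_dvd_mul_deriv (L : fieldType) (l : seq L) (g : {poly L}) :
  (forall c, c \in l -> root g c) ->
  \prod_(a <- l) ('X - a%:P) %| g * (\prod_(a <- l) ('X - a%:P))^`().
Proof.
elim: l => [|c l IH] rg; first by rewrite big_nil dvd1p.
rewrite big_cons derivM derivXsubC mul1r mulrDr dvdp_add //.
  by rewrite dvdp_mul // dvdp_XsubCl rg ?mem_head.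
by rewrite mulrCA dvdp_mul // IH // => a al; rewrite rg // inE al orbT.
Qed.

(** Each X - a is prime over a domain: it divides f or u, and in the second case it cancels. *)
Lemma split_or_dvd (A : idomainType) (l : seq A) (f u g : {poly A}) :
  f * u = (\prod_(a <- l) ('X - a%:P)) * g ->
  (exists2 a, a \in l & f.[a] = 0) \/ exists u', f * u' = g.
Proof.
elim: l u => [|a l IH] u; first by rewrite big_nil mul1r; right; exists u.
rewrite big_cons -mulrA => E; have := congr1 (fun h => h.[a]) E.
rewrite !hornerM hornerXsubC subrr mul0r => /eqP; rewrite mulf_eq0 => /orP[/eqP fa|ua].
  by left; exists a; rewrite ?mem_head.
have [u1 Eu] := factor_theorem u a ua.
case: (IH u1).
- apply: (mulfI (monic_neq0 (monicXsubC a))).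
  by rewrite -E Eu mulrCA (mulrC u1).
- by case=> c cl fc; left; exists c; rewrite // inE cl orbT.
- by right.
Qed.

(** * Total degree of polynomials in X over a multivariate polynomial ring *)

Section WeightedDegree.

Variables (L : finFieldType) (n : nat).
Implicit Types (P Q f g : {poly {mpoly L[n]}}).

(* Total degree at most [D], the polynomial variable having degree one. *)
Definition wdeg (D : nat) P := forall i, (msize P`_i <= D.+1 - i)%N.

Lemma wdegD D P Q : wdeg D P -> wdeg D Q -> wdeg D (P + Q).
Proof. by move=> dP dQ i; rewrite coefD; apply: msizeD_bound. Qed.

Lemma wdegN D P : wdeg D P -> wdeg D (- P).
Proof. by move=> dP i; rewrite coefN msizeN. Qed.

Lemma wdegM a b P Q : wdeg a P -> wdeg b Q -> wdeg (a + b) (P * Q).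
Proof.
move=> dP dQ i; rewrite coefM; apply: msize_sum_bound => j _.
have [aj|ja] := ltnP a j.
  by move: (dP j); rewrite (eqP (_ : a.+1 - j == 0)%N) ?subn_eq0 // leqn0
    msize_poly_eq0 => /eqP ->; rewrite mul0r msize0.
have [bj|jb] := ltnP b (i - j).
  by move: (dQ (i - j)%N); rewrite (eqP (_ : b.+1 - (i - j) == 0)%N) ?subn_eq0 // leqn0
    msize_poly_eq0 => /eqP ->; rewrite mulr0 msize0.
have -> : ((a + b).+1 - i = (a - j + (b - (i - j))).+1)%N by have := ltn_ord j; lia.
by apply: msizeM_bound; rewrite -subSn.
Qed.

Lemma wdegC D (c : {mpoly L[n]}) : (msize c <= D.+1)%N -> wdeg D c%:P.
Proof. by move=> dc [|i]; rewrite coefC ?subn0 // msize0. Qed.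

Lemma wdeg_sum D (I : Type) (r : seq I) (p : pred I) (F : I -> {poly {mpoly L[n]}}) :
  (forall i, p i -> wdeg D (F i)) -> wdeg D (\sum_(i <- r | p i) F i).
Proof.
move=> sF i; rewrite coef_sum; apply: msize_sum_bound => j pj; exact: sF.
Qed.

Lemma wdeg_prod (I : Type) (r : seq I) (d : I -> nat) (F : I -> {poly {mpoly L[n]}}) :
  (forall i, wdeg (d i) (F i)) -> wdeg (\sum_(i <- r) d i) (\prod_(i <- r) F i).
Proof.
move=> sF; elim: r => [|a r IH]; last by rewrite !big_cons; apply: wdegM.
by rewrite !big_nil; apply: wdegC; rewrite msize1.
Qed.

Lemma wdeg_horner D P (a : {mpoly L[n]}) :
  wdeg D P -> (msize a <= 2)%N -> (msize P.[a] <= D.+1)%N.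
Proof.
move=> dP sa; rewrite horner_coef; apply: msize_sum_bound => i _.
have [Di|iD] := ltnP D i.
  by move: (dP i); rewrite (eqP (_ : D.+1 - i == 0)%N) ?subn_eq0 // leqn0
    msize_poly_eq0 => /eqP ->; rewrite mul0r msize0.
have sai : (msize (a ^+ i) <= i.+1)%N.
  elim: (nat_of_ord i) => [|h IH]; first by rewrite expr0 msize1.
  by rewrite exprS; apply: (msizeM_bound (a := 1) sa IH).
rewrite -(subnK iD); apply: msizeM_bound => //.
by rewrite -subSn.
Qed.

(** Long division by a monic f of total degree k only subtracts terms of total degree at most D, so
    the remainder inherits the bound. *)
Lemma wdeg_divmod k D f g : f \is monic -> size f = k.+1 -> wdeg k f -> wdeg D g ->
  exists2 uv : {poly {mpoly L[n]}} * {poly {mpoly L[n]}},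
    g = f * uv.1 + uv.2 & (size uv.2 <= k)%N /\ wdeg D uv.2.
Proof.
move=> mf sf df; move: {2}(size g) (leqnn (size g)) => h.
elim: h g => [|h IH] g sg dg.
  by exists (0, g); rewrite /= ?mulr0 ?add0r //; split=> //; apply: leq_trans sg _.
have [gk|kg] := leqP (size g) k.
  by exists (0, g); rewrite /= ?mulr0 ?add0r.
have sg' : size g = (size g).-1.+1 by rewrite prednK // (leq_trans _ kg).
set N := (size g).-1 in sg'.
have ND : (N <= D)%N.
  rewrite leqNgt; apply/negP => DN; have := dg N.
  rewrite (eqP (_ : D.+1 - N == 0)%N) ?subn_eq0 // leqn0 msize_poly_eq0.
  by rewrite -/(lead_coef g) lead_coef_eq0 => /eqP g0; rewrite g0 size_poly0 in sg'.
have kN : (k <= N)%N by rewrite -ltnS -sg'.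
pose c : {poly {mpoly L[n]}} := (lead_coef g)%:P * 'X^(N - k).
have dc : wdeg (D - k) c.
  move=> i; rewrite coefCM coefXn; case: eqP => [->|_]; last by rewrite mulr0 msize0.
  rewrite mulr1; have := dg N; rewrite -/(lead_coef g); move/leq_trans; apply; lia.
have [||uv Eg [suv duv]] := IH (g - f * c).
- have sfc : (size (f * c)%R <= N.+1)%N.
    apply: leq_trans (size_polyMleq _ _) _; rewrite sf /=.
    have : (size c <= (N - k).+1)%N.
      by rewrite /c mul_polyC (leq_trans (size_scale_leq _ _)) // size_polyXn.
    move=> sc; apply: leq_trans (leq_add (leqnn k) sc) _.
    by rewrite addnS subnKC.
  rewrite -ltnS; apply: leq_trans sg; rewrite sg' ltnS.
  apply/leq_sizeP => j; rewrite leq_eqVlt => /orP[/eqP <-|Nj]; last first.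
    by rewrite coefB !nth_default ?subr0 // ?sg' // (leq_trans sfc).
  rewrite coefB /c mulrA (mulrC f) -mulrA coefCM coefMXn ltnNge leq_subr /= subKn //.
  have -> : f`_k = 1 by have /monicP := mf; rewrite /lead_coef sf.
  by rewrite mulr1 subrr.
- apply: wdegD => //; apply: wdegN.
  have -> : D = (k + (D - k))%N by lia.
  exact: wdegM.
exists (uv.1 + c, uv.2) => //=.
by rewrite mulrDr addrAC -Eg subrK.
Qed.

End WeightedDegree.

(** * Multisets of hyperplanes and their counts modulo the characteristic *)

Section HyperplaneCounts.

Variables (L : finFieldType) (n : nat).
Local Notation q := #|L|.
Implicit Types (b : 'rV[L]_n) (x y z : 'I_n -> L) (s : seq 'rV[L]_n).

Definition dot b x : L := \sum_j b 0 j * x j.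

Definition lin b : {mpoly L[n]} := \sum_j b 0 j *: 'X_j.

Definition hcount s x := count (fun b => dot b x == 0) s.

Lemma lin_eval b x : (lin b).@[x] = dot b x.
Proof. by rewrite raddf_sum /=; apply: eq_bigr => j _; rewrite mevalZ mevalXU. Qed.

Lemma msize_lin b : (msize (lin b) <= 2)%N.
Proof.
apply: msize_sum_bound => j _.
by apply: leq_trans (msizeZ_le _ _) _; rewrite msizeX mdeg1.
Qed.

Lemma lin_neq0 b : b != 0 -> lin b != 0.
Proof.
apply: contra => /eqP l0; apply/eqP/rowP => j; rewrite mxE.
have := congr1 (mcoeff U_(j)%MM) l0; rewrite raddf_sum mcoeff0 (bigD1 j) //=.
rewrite mcoeffZ mcoeffX eqxx mulr1 big1 ?addr0 // => i ij.
rewrite mcoeffZ mcoeffX; case: eqP => [E|]; last by rewrite mulr0.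
by have := congr1 (fun m : 'X_{1..n} => m j) E; rewrite !mnm1E eqxx (negbTE ij).
Qed.

Lemma dotD b x y : dot b (fun j => x j + y j) = dot b x + dot b y.
Proof. by rewrite -big_split; apply: eq_bigr => j _; rewrite mulrDr. Qed.

Lemma dotZ b c x : dot b (fun j => c * x j) = c * dot b x.
Proof. by rewrite mulr_sumr; apply: eq_bigr => j _; rewrite mulrCA. Qed.

Lemma line_lin y z b : line y z (lin b) = (dot b y)%:P + dot b z *: 'X.
Proof.
rewrite /lin raddf_sum /= /dot scaler_suml (raddf_sum polyC) -big_split /=.
apply: eq_bigr => j _; rewrite /line mmapZ mmapX mmap1U mulrDr -polyCM.
by rewrite -!mul_polyC !polyCM mulrA.
Qed.

Lemma msize_prod_lin s (p : pred 'rV[L]_n) :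
  (msize (\prod_(b <- s | p b) lin b) <= (count p s).+1)%N.
Proof.
elim: s => [|b s IH]; first by rewrite big_nil msize1.
rewrite big_cons /=; case: (p b) => //.
exact: (msizeM_bound (a := 1) (msize_lin b) IH).
Qed.

(** Every form vanishing at y contributes one factor X. The value of G at 0 exhibits the leading
    form in z, up to a nonzero constant, as the product of the forms through y. *)
Lemma line_prod_lin s y z : exists2 G : {poly L},
  line y z (\prod_(b <- s) lin b) = 'X^(hcount s y) * G &
  G.[0] = (\prod_(b <- s | dot b y == 0) dot b z) *
          \prod_(b <- s | dot b y != 0) dot b y.
Proof.
exists ((\prod_(b <- s | dot b y == 0) (dot b z)%:P) *
        \prod_(b <- s | dot b y != 0) line y z (lin b)).
  rewrite rmorph_prod (bigID (fun b => dot b y == 0)) /= mulrA; congr (_ * _).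
  rewrite (eq_bigr (fun b => 'X * (dot b z)%:P)) => [|b /eqP by0].
    by rewrite big_split /= big_const_seq iter_mulr mulr1.
  by rewrite line_lin by0 add0r -mul_polyC mulrC.
rewrite hornerM !horner_prod; congr (_ * _).
  by apply: eq_bigr => b _; rewrite hornerC.
by apply: eq_bigr => b _; rewrite line_lin hornerD hornerC hornerZ hornerX mulr0 addr0.
Qed.

End HyperplaneCounts.

(** * The congruence modulo p in dual form *)

Section ModP.

Variables (L : finFieldType) (n t p : nat) (s : seq 'rV[L]_n).
Local Notation q := #|L|.
Hypothesis chp : p \in [pchar L].
Hypothesis t_gt0 : (0 < t)%N.
Hypothesis s_neq0 : forall b, b \in s -> b != 0.
Hypothesis blocking : forall (x : 'I_n -> L) j, x j != 0 -> (t <= hcount s x)%N.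
Hypothesis s_size : (2 * size s + 1 <= (2 * t + 1) * q)%N.
Hypothesis minimal : forall b, b \in s ->
  exists x : 'I_n -> L, [/\ exists j, x j != 0, dot b x = 0 & hcount s x = t].
Variables (e x0 : 'I_n -> L).
Hypothesis e_count : hcount s e = t.

(** Excludes the forms that vanish identically along y + X e. The excluded y are the zeros of the
    product of the t forms through e, see [through_form]. *)
Definition generic y := all (fun b => (dot b e == 0) ==> (dot b y != 0)) s.
Hypothesis x0_generic : generic x0.

Let A := {mpoly L[n]}.

(* Up to a factor free of X, [transverse_poly] is R(y + X e) for the product R of the
   forms in [s].  At a generic y it specializes to (X^q - X)^t times the monic
   polynomial with roots [excess y], which is the specialization of [top_part]. *)
Definition transverse := [seq b <- s | dot b e != 0].
Definition excess_size := (size transverse - t * q)%N.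
Local Notation k := excess_size.

Definition root_form b : A := - (dot b e)^-1 *: lin b.
Definition root_at y b : L := - (dot b e)^-1 * dot b y.
Definition transverse_poly : {poly A} := \prod_(b <- transverse) ('X - (root_form b)%:P).
Definition shift (c : L) y j := y j + c * e j.

Lemma dot_shift b c y : dot b (shift c y) = dot b y + c * dot b e.
Proof. by rewrite -dotZ -dotD. Qed.

Lemma hcount_generic y c : generic y ->
  hcount s (shift c y) = count_mem c [seq root_at y b | b <- transverse].
Proof.
move=> /allP gy; rewrite count_map count_filter; apply: eq_in_count => b bs /=.
rewrite dot_shift /root_at; have := gy b bs.
have [->|be] /= := eqVneq (dot b e) 0; first by rewrite mulr0 addr0 andbF => /negbTE.
move=> _; rewrite andbT; apply/eqP/eqP => [/eqP|<-].
  by rewrite addr_eq0 => /eqP ->; rewrite mulNr mulrN opprK mulrC mulfK.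
by rewrite mulNr mulNr mulrAC mulVf // mul1r subrr.
Qed.

Lemma size_transverse : (size transverse + t = size s)%N.
Proof. by rewrite -e_count size_filter addnC -(count_predC (fun b => dot b e == 0)). Qed.

Lemma generic_shift_neq0 y c : generic y -> exists j, shift c y j != 0.
Proof.
move=> /allP gy; apply/existsP; rewrite -negb_forall; apply/negP => /forallP sh0.
have : (0 < hcount s e)%N by rewrite e_count.
rewrite -has_count => /hasP[b bs be]; move: (gy b bs); rewrite be /=.
have : dot b (shift c y) = 0.
  by apply: big1 => j _; rewrite (eqP (sh0 j)) mulr0.
by rewrite dot_shift (eqP be) mulr0 addr0 => ->; rewrite eqxx.
Qed.

Definition excess y := flatten [seq nseq (hcount s (shift c y) - t) c | c <- enum L].

Lemma excess_count y c : count_mem c (excess y) = (hcount s (shift c y) - t)%N.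
Proof. exact: (count_flatten_nseq (fun c => hcount s (shift c y) - t)%N). Qed.

Lemma roots_perm y : generic y -> perm_eq [seq root_at y b | b <- transverse]
  (flatten [seq nseq t c | c <- enum L] ++ excess y).
Proof.
move=> gy; rewrite /perm_eq; apply/allP => c _ /=.
rewrite count_cat excess_count (count_flatten_nseq (fun=> t)) -hcount_generic //.
by rewrite subnKC //; have [j] := generic_shift_neq0 c gy; apply: blocking.
Qed.

Lemma size_excess y : generic y -> (t * q + size (excess y) = size transverse)%N.
Proof.
move=> gy; rewrite -(size_map (root_at y)) (perm_size (roots_perm gy)) size_cat.
congr (_ + _)%N; rewrite size_flatten /shape -map_comp sumnE big_map big_enum /=.
by rewrite (eq_bigr (fun=> t)) => [|c _]; rewrite ?size_nseq // sum_nat_const mulnC.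
Qed.

Lemma excess_sizeE : (t * q + k = size transverse)%N.
Proof. by rewrite /k subnKC // -(size_excess x0_generic) leq_addr. Qed.

Lemma excess_size_bound : (2 * t + 2 * k + 1 <= q)%N.
Proof.
have := s_size; rewrite -size_transverse -excess_sizeE mulnDl mul1n.
by move: #|L| t k => Q T K; nia.
Qed.

Lemma size_excess_generic y : generic y -> size (excess y) = k.
Proof. by move=> /size_excess E; apply/eqP; rewrite -(eqn_add2l (t * q)) E excess_sizeE. Qed.

Lemma transverse_poly_eval y : generic y -> map_poly (meval y) transverse_poly =
  ('X^q - 'X) ^+ t * \prod_(c <- excess y) ('X - c%:P).
Proof.
move=> gy; rewrite rmorph_prod /=.
rewrite (eq_bigr (fun b => 'X - (root_at y b)%:P)) => [|b _]; last first.
  by rewrite rmorphB /= map_polyX map_polyC /= mevalZ lin_eval.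
rewrite -(big_map (root_at y) xpredT (fun c => 'X - c%:P)) /=.
rewrite (perm_big _ (roots_perm gy)) big_cat /=; congr (_ * _).
by rewrite (prod_flatten_nseq (fun=> t)) prodrXl finField_genPoly.
Qed.

(** Stands in for the quotient by (X^q - X)^t, which is exact only after specialization at a generic
    y. Discarding the low coefficients instead gives an object that is polynomial in y. *)
Definition top_part : {poly A} := drop_poly (t * q) transverse_poly.
Local Notation f := top_part.

Lemma size_transverse_poly : size transverse_poly = (size transverse).+1.
Proof. by rewrite size_prod_XsubC. Qed.

Lemma size_top_part : size f = k.+1.
Proof. by rewrite size_drop_poly size_transverse_poly -excess_sizeE -addnS addKn. Qed.

Lemma top_part_monic : f \is monic.
Proof.
rewrite monicE /lead_coef size_top_part /= coef_drop_poly addnC excess_sizeE.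
have := monic_prod_XsubC transverse xpredT root_form.
by rewrite monicE /lead_coef -/transverse_poly size_transverse_poly.
Qed.

Lemma wdeg_top_part : wdeg k f.
Proof.
have dR : wdeg (size transverse) transverse_poly.
  rewrite -sum1_size; apply: wdeg_prod => b i; rewrite coefB coefX coefC.
  case: i => [|[|i]] /=; rewrite ?subr0 ?sub0r ?msizeN ?msize0 ?msize1 //.
  by apply: leq_trans (msizeZ_le _ _) _; exact: msize_lin.
move=> i; rewrite coef_drop_poly; apply: leq_trans (dR _) _; rewrite -excess_sizeE.
by rewrite -addnS addnC subnDr.
Qed.

(** Apart from X^(tq), the terms of (X^q - X)^t have degree at most tq - q + 1. Since k + 1 < q,
    multiplying them by a polynomial of degree k stays below degree tq. *)
Lemma top_part_eval y : generic y -> map_poly (meval y) f = \prod_(c <- excess y) ('X - c%:P).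
Proof.
move=> gy; have -> : map_poly (meval y) f = drop_poly (t * q) (map_poly (meval y) transverse_poly).
  by apply/polyP => i; rewrite coef_map !coef_drop_poly coef_map.
rewrite transverse_poly_eval //; set g := \prod_(c <- _) _.
have sg : size g = k.+1 by rewrite size_prod_XsubC size_excess_generic.
have [h Eh sh] : exists2 h : {poly L}, ('X^q - 'X) ^+ t = h + 'X^(t * q) &
    (size h <= t * q - q + 2)%N.
  exists (('X^q - 'X) ^+ t - 'X^q ^+ t); first by rewrite mulnC exprM subrK.
  have q1 : (1 < q)%N := finNzRing_gt1 L.
  have sq : size ('X^q - 'X : {poly L}) = q.+1.
    by rewrite size_polyDl size_polyXn // size_polyN size_polyX.
  rewrite subrXX addrAC subrr sub0r mulNr size_polyN.
  apply: leq_trans (size_polyMleq _ _) _; rewrite size_polyX /=.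
  have -> : (t * q - q + 2 = (t.-1 * q).+2)%N.
    by rewrite addn2 -{2}[q]mul1n -mulnBl subn1.
  rewrite ltnS; apply: leq_trans (size_sum _ _ _) _; apply/bigmax_leqP => i _.
  apply: leq_trans (size_polyMleq _ _) _; rewrite -exprM size_polyXn addnS /=.
  apply: leq_trans (leq_add (size_poly_exp_leq _ _) (leqnn _)) _.
  rewrite sq /= addSn ltnS -mulnDr mulnC leq_mul2r; apply/orP; right.
  by have := ltn_ord i; lia.
rewrite Eh mulrDl ['X^_ * _]mulrC; apply: drop_polyDMXn.
apply: leq_trans (size_polyMleq _ _) _; rewrite sg addnS /=.
have qtq : (q <= t * q)%N by rewrite leq_pmull.
apply: leq_trans (leq_add sh (leqnn k)) _; have := excess_size_bound.
by move: qtq; move: (t * q)%N #|L| => a b; lia.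
Qed.

Definition translate : A -> {poly A} :=
  mmap (polyC \o @mpolyC n L) (fun j => ('X_j)%:P + (e j)%:MP *: 'X).
HB.instance Definition _ := GRing.RMorphism.copy translate
  (mmap (polyC \o @mpolyC n L) (fun j => ('X_j)%:P + (e j)%:MP *: 'X)).

Lemma translate_eval P y c : (map_poly (meval y) (translate P)).[c] = P.@[shift c y].
Proof.
rewrite /translate /mmap raddf_sum horner_sum mevalE; apply: eq_bigr => m _ /=.
rewrite rmorphM hornerM /= map_polyC hornerC /= mevalC; congr (_ * _).
rewrite rmorph_prod horner_prod; apply: eq_bigr => j _.
rewrite rmorphXn horner_exp /= rmorphD /= map_polyC map_polyZ map_polyX /=.
by rewrite mevalXU mevalC hornerD hornerC hornerZ hornerX mulrC.
Qed.

Lemma translate_lin b : translate (lin b) = (lin b)%:P + (dot b e)%:MP *: 'X.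
Proof.
rewrite /lin raddf_sum /= /dot (raddf_sum polyC) raddf_sum scaler_suml -big_split /=.
apply: eq_bigr => j _; rewrite /translate mmapZ mmapX mmap1U /= mulrDr -polyCM mul_mpolyC.
by rewrite mul_polyC scalerA mpolyCM.
Qed.

Lemma wdeg_translate D P : (msize P <= D.+1)%N -> wdeg D (translate P).
Proof.
move=> sP; rewrite /translate /mmap big_seq; apply: wdeg_sum => m mP.
have mD : (mdeg m <= D)%N by rewrite -ltnS (leq_trans (msize_mdeg_lt mP)).
have -> : D = (0 + D)%N by []; apply: wdegM.
  by apply: wdegC => /=; rewrite msizeC; case: eqP.
suff H : wdeg (mdeg m) (mmap1 (fun j => ('X_j)%:P + (e j)%:MP *: 'X) m).
  by move=> i; apply: leq_trans (H i) _; lia.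
rewrite mdegE; apply: wdeg_prod => j.
elim: (m j) => [|h IH]; first by rewrite expr0; apply: wdegC; rewrite msize1.
rewrite exprS -add1n; apply: wdegM => //; apply: wdegD.
  by apply: wdegC; rewrite msizeX mdeg1.
move=> [|[|i]]; rewrite coefZ coefX ?mulr0 ?mulr1 ?msize0 // msizeC; by case: eqP.
Qed.

Definition through_form : A := \prod_(b <- s | dot b e == 0) lin b.

Lemma through_form_neq0 : through_form != 0.
Proof.
rewrite /through_form big_seq_cond prodf_seq_neq0; apply/allP => b bs.
by apply/implyP => /andP[/s_neq0 /lin_neq0].
Qed.

Lemma msize_through_form : (msize through_form <= t.+1)%N.
Proof. by rewrite -e_count; apply: msize_prod_lin. Qed.

(** [through_form] has degree t and kills the non-generic points, so the product vanishes
    everywhere; its degree is at most 2k + 2t < q. Here the size bound is used with its exact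
    constant. *)
Lemma vanish_generic (Q : A) : (msize Q <= (2 * k + t).+1)%N ->
  (forall y, generic y -> Q.@[y] = 0) -> Q = 0.
Proof.
move=> sQ vQ; suff : Q * through_form = 0.
  by move/eqP; rewrite mulf_eq0 (negbTE through_form_neq0) orbF => /eqP.
apply: mpoly_vanish => [|y].
  apply: leq_trans (msizeM_bound sQ msize_through_form) _; have := excess_size_bound.
  by move: #|L| => a; lia.
rewrite mevalM; have [gy|] := boolP (generic y); first by rewrite vQ // mul0r.
rewrite -has_predC => /hasP[b bs /=]; rewrite negb_imply negbK => /andP[be by0].
rewrite [X in _ * X](_ : _ = 0) ?mulr0 // rmorph_prod; apply/eqP.
rewrite prodf_seq_eq0; apply/hasP; exists b => //=.
by rewrite be lin_eval.
Qed.

Let R : A := \prod_(b <- s) lin b.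

Lemma translate_R : translate R =
  (through_form * \prod_(b <- transverse) (dot b e)%:MP)%:P * transverse_poly.
Proof.
rewrite /R rmorph_prod /= (bigID (fun b => dot b e == 0)) /= polyCM -mulrA.
congr (_ * _).
  rewrite /through_form rmorph_prod; apply: eq_bigr => b /eqP be.
  by rewrite translate_lin be mpolyC0 scale0r addr0.
rewrite -big_filter -/transverse rmorph_prod /transverse_poly -big_split /= big_seq [RHS]big_seq.
apply: eq_bigr => b; rewrite mem_filter => /andP[be _].
rewrite translate_lin mulrBr -!mul_polyC -polyCM addrC; congr (_ + _).
rewrite -polyCN; congr (_%:P); rewrite /root_form mul_mpolyC scalerA mulrN divff //.
by rewrite scaleN1r opprK.
Qed.

Lemma msize_R : (msize R <= (size s).+1)%N.
Proof. by apply: leq_trans (msize_prod_lin s xpredT) _; rewrite count_predT. Qed.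

Lemma R_order y z : 'X^(hcount s y) %| line y z R.
Proof. by have [G -> _] := line_prod_lin s y z; rewrite dvdp_mulr. Qed.

Lemma t_lt_q : (t < q)%N.
Proof. by have := excess_size_bound; lia. Qed.

(* [f] divides every [translate (r m) * f^`()], since the former factor vanishes
   at the roots of [f].  Hence [f] divides a factor free of X times the product of the
   [X - root_form b] times [f^`()].  If some [root_form b] were a root of [f],
   then all the [r m] would vanish on the hyperplane [b], contradicting a point
   of it lying on exactly [t] hyperplanes. *)
Lemma top_part_deriv0 : f^`() = 0.
Proof.
have [y z|r ER sr] := @vanish_frob_power L n t (size s).+1 R (ltnW t_lt_q) msize_R.
  have [/existsP[j yj]|/existsPn y0] := boolP [exists j, y j != 0].
    by apply: dvdp_trans (R_order y z); apply: dvdp_exp2l; apply: blocking yj.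
  apply: dvdp_trans (R_order y z); apply: dvdp_exp2l.
  rewrite (_ : hcount s y = size s); first by rewrite -size_transverse leq_addl.
  apply/eqP; rewrite /hcount -all_count; apply/allP => b _ /=.
  by apply/eqP; apply: big1 => j _; rewrite (eqP (negPn (y0 j))) mulr0.
have sr' m : (msize (r m) <= (t + k).+1)%N.
  apply: leq_trans (sr m) _; rewrite -size_transverse -excess_sizeE.
  by move: (t * q)%N k => a c; lia.
have vr m x : mdeg m = t -> (t < hcount s x)%N -> (r m).@[x] = 0.
  move=> dm tx; apply: (frob_coef_vanish t_lt_q ER) dm => z.
  by apply: dvdp_trans (R_order x z); apply: dvdp_exp2l.
have root_gt y c : generic y -> c \in excess y -> (t < hcount s (shift c y))%N.
  by move=> gy; rewrite -has_pred1 has_count excess_count subn_gt0.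
have dvd m : mdeg m = t -> exists u, f * u = translate (r m) * f^`().
  move=> dm; have wf' : wdeg k.-1 f^`().
    move=> i; rewrite coef_deriv; have := wdeg_top_part i.+1.
    rewrite -mulr_natl mulr_natl; case: k => [|h] /= H.
      by move: H; rewrite leqn0 msize_poly_eq0 => /eqP ->; rewrite mul0rn msize0.
    by apply: leq_trans H; rewrite -scaler_nat msizeZ_le.
  (* The remainder has coefficients of degree at most 2k + t, within reach of [vanish_generic]. At a
     generic y it is a multiple of the specialized f but of smaller degree, hence zero. *)
  have wg : wdeg (t + k + k.-1) (translate (r m) * f^`()).
    by apply: wdegM; first exact: wdeg_translate.
  have [[u v] /= E [sv wv]] := wdeg_divmod top_part_monic size_top_part wdeg_top_part wg.
  exists u; suff v0 : v = 0 by rewrite E v0 addr0.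
  apply/polyP => i; rewrite coef0; apply: vanish_generic => [|y gy].
    by apply: leq_trans (wv i) _; lia.
  have vy0 : map_poly (meval y) v = 0.
    apply/eqP; apply: contraTT (leqnn k) => v0; rewrite -ltnNge.
    have sf : size (map_poly (meval y) f) = k.+1.
      by rewrite top_part_eval // size_prod_XsubC size_excess_generic.
    rewrite -{1}sf; apply: leq_trans (dvdp_leq v0 _) _; last first.
      by apply: leq_trans sv; apply: size_poly.
    have := congr1 (map_poly (meval y)) E; rewrite !rmorphM rmorphD /= rmorphM /= => Ey.
    suff : map_poly (meval y) f %| map_poly (meval y) f * map_poly (meval y) u +
        map_poly (meval y) v by rewrite dvdp_addr // dvdp_mulr.
    rewrite -Ey -deriv_map top_part_eval //.
    apply: split_dvd_mul_deriv => c ce; rewrite /root translate_eval vr //.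
    exact: root_gt.
  by have := congr1 (fun h : {poly L} => h`_i) vy0; rewrite coef_map coef0.
have [u Eu] : exists u, f * u = translate R * f^`().
  rewrite ER rmorph_sum mulr_suml /=.
  elim/big_ind: _ => [|a b [ua <-] [ub <-]|m /eqP dm].
  - by exists 0; rewrite mulr0.
  - by exists (ua + ub); rewrite mulrDr.
  - have [u Eu] := dvd m dm; exists (translate (frobm L m) * u).
    by rewrite rmorphM /= mulrCA Eu mulrA.
move: Eu; rewrite translate_R (mulrC (_%:P)) /transverse_poly -mulrA.
rewrite -(big_map root_form xpredT (fun a => 'X - a%:P)).
case/split_or_dvd => [[_ /mapP[b bs1 ->]] fb|[u' Eu]]; last first.
  set c := (X in X%:P * _) in Eu; have c0 : c != 0.
    rewrite mulf_neq0 ?through_form_neq0 // prodf_seq_neq0; apply/allP => b /=.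
    by rewrite mem_filter mpolyC_eq0 => /andP[].
  apply/eqP; apply: contraTT (leqnn k) => f'0; rewrite -ltnNge.
  have fu0 : f * u' != 0 by rewrite Eu mulf_neq0 // polyC_eq0.
  have [f0 u'0] : f != 0 /\ u' != 0 by apply/andP; rewrite -negb_or -mulf_eq0.
  have : (size f <= size (f * u')%R)%N.
    by rewrite size_mul // -subn1 -addnBA ?leq_addr // size_poly_gt0.
  rewrite Eu mul_polyC size_scale // => H.
  by have := leq_ltn_trans H (lt_size_deriv f0); rewrite ltnn.
exfalso; have [be bs] : dot b e != 0 /\ b \in s by move: bs1; rewrite mem_filter => /andP[].
have root_form_eval y : (root_form b).@[y] = root_at y b by rewrite mevalZ lin_eval.
have translate_b m : mdeg m = t -> (translate (r m)).[root_form b] = 0.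
  move=> dm; apply: vanish_generic => [|y gy].
    apply: leq_trans (wdeg_horner (wdeg_translate (sr' m)) _) _.
      by apply: leq_trans (msizeZ_le _ _) _; apply: msize_lin.
    by lia.
  rewrite -horner_map /= translate_eval vr //; apply: root_gt => //.
  have : root (map_poly (meval y) f) (root_at y b).
    by rewrite /root -root_form_eval horner_map /= fb meval0.
  by rewrite top_part_eval // root_prod_XsubC root_form_eval.
(* As b vanishes at x, the root attached to b is 0 there, so [translate_b] yields the value of r m
   at x itself. *)
have [x [_ bx cx]] := minimal bs.
have rx m : mdeg m = t -> (r m).@[x] = 0.
  move=> dm; have := congr1 (meval x) (translate_b m dm).
  rewrite meval0 -horner_map /= translate_eval root_form_eval /root_at bx mulr0.
  by rewrite (meval_eq (v2 := x)) // => j; rewrite /shift mul0r addr0.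
(* With all r m zero at x, R vanishes at x to order t + 1. Its form of order t, a constant times the
   product of the t forms through x, is then zero at every z, and its degree t is below q. *)
have prod0 : \prod_(c <- s | dot c x == 0) lin c = 0.
  apply: mpoly_vanish => [|z].
    by apply: leq_trans (msize_prod_lin _ _) _; rewrite -/(hcount s x) cx t_lt_q.
  have [G EG G0] := line_prod_lin s x z.
  have : 'X^(t.+1) %| line x z R.
    rewrite ER raddf_sum /=; elim/big_ind: _ => [|a b' da db|m /eqP dm].
    - exact: dvdp0.
    - exact: dvdp_add.
    rewrite rmorphM /= line_frobm dm exprSr -scalerAl -mul_polyC dvdp_mull //.
    apply: dvdp_mul; last first.
      by rewrite -['X]subr0 dvdp_XsubCl /root line_at0 rx.
    apply: dvdp_exp2r; rewrite dvdp_sub // -(prednK (ltnW (finNzRing_gt1 L))).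
    by rewrite exprS dvdp_mulr.
  rewrite EG cx exprSr dvdp_mul2l ?monic_neq0 ?monicXn // -['X]subr0 dvdp_XsubCl.
  rewrite /root G0 mulf_eq0 orbC prodf_seq_eq0 => /orP[/hasP[c _ /= /andP[/negbTE ->]] //|].
  move/eqP => z0; rewrite rmorph_prod -[RHS]z0.
  by apply: eq_bigr => c _; apply: lin_eval.
move/eqP: prod0; apply/negP; rewrite big_seq_cond prodf_seq_neq0.
by apply/allP => c _; apply/implyP => /andP[/s_neq0 /lin_neq0].
Qed.

(** The excess at x0 is the multiplicity of the root 0 of the specialized f, and multiplicities are
    divisible by p once the derivative is zero. *)
Theorem hcount_mod : (p %| hcount s x0 - t)%N.
Proof.
have : (\prod_(c <- excess x0) ('X - c%:P))^`() = 0.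
  by rewrite -top_part_eval // deriv_map top_part_deriv0 rmorph0.
move/(deriv_prod_XsubC0 0 chp); rewrite excess_count.
congr (p %| _ - _)%N; apply: eq_count => b.
by congr (_ == _); apply: eq_bigr => j _; rewrite /shift mul0r addr0.
Qed.

End ModP.

(** * Weights on vectors *)

(* A weighted point set is encoded as a function on vectors, constant on the
   nonzero vectors of each line, so [mass] counts every point [p.-1] times. *)
Section Mass.

Variable F : finFieldType.
Local Notation p := #|F|.

Lemma dim_rV m : \dim {: 'rV[F]_m} = m.
Proof. by rewrite dimvf /dim /= mul1n. Qed.

Lemma card_gt1 : (1 < p)%N.
Proof. exact: finNzRing_gt1. Qed.

Lemma exists_subspace m d (U : {vspace 'rV[F]_m}) : (d <= \dim U)%N ->
  exists2 W : {vspace 'rV[F]_m}, (W <= U)%VS & \dim W = d.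
Proof.
move=> dU; have fU := basis_free (vbasisP U).
pose X := take d (vbasis U).
have fX : free X by apply: (@catl_free _ _ (drop d (vbasis U))); rewrite cat_take_drop.
exists <<X>>%VS.
  by apply/span_subvP => v /mem_take; apply: vbasis_mem.
by move: fX; rewrite /free => /eqP ->; rewrite size_take size_tuple; case: ltngtP dU.
Qed.

Lemma exists_supspace m d (U : {vspace 'rV[F]_m}) : (\dim U <= d <= m)%N ->
  exists2 W : {vspace 'rV[F]_m}, (U <= W)%VS & \dim W = d.
Proof.
case/andP=> Ud dm; have dC : \dim (U^C) = (m - \dim U)%N.
  by rewrite dimv_compl dim_rV.
have [|W WC dW] := @exists_subspace m (d - \dim U) (U^C)%VS; first by rewrite dC leq_sub2r.
exists (U + W)%VS; first exact: addvSl.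
rewrite dimv_disjoint_sum ?dW ?subnKC //; apply/eqP.
by rewrite -subv0 -(capv_compl U) capvS.
Qed.

Lemma exists_quotient m d (W : {vspace 'rV[F]_m}) : (\dim W + d = m)%N ->
  exists g : 'Hom('rV[F]_m, 'rV[F]_d), lker g = W.
Proof.
move=> dW; have dC : \dim (W^C) = d by rewrite dimv_compl dim_rV; lia.
pose C := (W^C)%VS.
have CW : (C :&: W)%VS = 0%VS by rewrite capvC capv_compl.
have WCT : (W + C)%VS = fullv := addv_complf W.
pose h v : 'rV[F]_d := \row_i coord (vbasis C) (cast_ord (esym dC) i) (daddv_pi C W v).
have hlin : linear h.
  by move=> a u v; apply/rowP => i; rewrite !mxE !linearP.
pose hL : {linear 'rV[F]_m -> 'rV[F]_d} :=
  HB.pack h (GRing.isLinear.Build _ _ _ _ h hlin).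
exists (linfun hL); apply/vspaceP => v; rewrite memv_ker lfunE /=.
have piC : daddv_pi C W v \in C by apply: memv_pi.
have vE : daddv_pi C W v + daddv_pi W C v = v.
  by apply: daddv_pi_add => //; rewrite addvC WCT memvf.
apply/eqP/idP => [h0|vW].
  rewrite -vE; suff -> : daddv_pi C W v = 0 by rewrite add0r memv_pi.
  rewrite (coord_vbasis piC) big1 // => i _.
  have /rowP/(_ (cast_ord dC i)) := h0.
  by rewrite !mxE cast_ordK => ->; rewrite scale0r.
have E0 : daddv_pi C W v = 0.
  apply/eqP; rewrite -memv0 -CW memv_cap piC /=.
  have -> : daddv_pi C W v = v - daddv_pi W C v by rewrite -{2}vE addrK.
  by rewrite memvB // memv_pi.
by apply/rowP => i; rewrite !mxE E0 linear0.
Qed.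

Lemma exists_embedding (vT : vectType F) d (U : {vspace vT}) : \dim U = d ->
  exists g : 'Hom('rV[F]_d, vT), lker g = 0%VS /\ limg g = U.
Proof.
move=> dU; pose h (a : 'rV[F]_d) : vT := \sum_(i < d) a 0 i *: (vbasis U)`_i.
have hlin : linear h.
  move=> c u v; rewrite /h scaler_sumr -big_split; apply: eq_bigr => i _ /=.
  by rewrite !mxE scalerDl scalerA.
pose hL : {linear 'rV[F]_d -> vT} :=
  HB.pack h (GRing.isLinear.Build _ _ _ _ h hlin).
have ker0 : lker (linfun hL) = 0%VS.
  apply/vspaceP => v; rewrite memv_ker memv0 lfunE /=.
  apply/eqP/eqP => [h0|->]; last by rewrite /h big1 // => i _; rewrite mxE scale0r.
  have fU : free (tcast dU (vbasis U)) by rewrite val_tcast; apply: basis_free (vbasisP U).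
  apply/rowP => i; rewrite mxE; move/freeP: fU => /(_ (fun i => v 0 i)); apply.
  rewrite -[RHS]h0 /h; apply: eq_bigr => j _.
  by rewrite val_tcast.
exists (linfun hL); split=> //; apply/eqP; rewrite eqEdim; apply/andP; split.
  apply/subvP => _ /memv_imgP[a _ ->]; rewrite lfunE /= memv_suml // => i _.
  by rewrite memvZ // vbasis_mem // mem_nth // size_tuple dU.
by rewrite limg_dim_eq ?ker0 ?capv0 // dim_rV dU.
Qed.

Variable m : nat.
Implicit Types (w : 'rV[F]_m -> nat) (U W : {vspace 'rV[F]_m}) (u v : 'rV[F]_m).

Definition scale_inv w := forall a v, a != 0 -> w (a *: v) = w v.

Definition mass w U := (\sum_(v | (v != 0%R) && (v \in U)) w v)%N.

Lemma card_nonzero U : #|[pred v | (v != 0) && (v \in U)]| = (p ^ \dim U - 1)%N.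
Proof.
have <- := card_vspace U; rewrite (cardD1 0 (mem U)) mem0v /= add1n subn1.
by apply: eq_card => v; rewrite !inE.
Qed.

Lemma mass_const c U : mass (fun=> c) U = (c * (p ^ \dim U - 1))%N.
Proof. by rewrite /mass sum_nat_const card_nonzero mulnC. Qed.

Lemma mass_indicator U W : mass (fun v => (v \in W) : nat) U = (p ^ \dim (U :&: W) - 1)%N.
Proof.
rewrite -card_nonzero -sum1_card /mass [RHS]big_mkcond [LHS]big_mkcond /=.
apply: eq_bigr => v _. rewrite inE memv_cap.
by case: (v == 0) => //=; case: (v \in U).
Qed.

Lemma leq_mass w w' U : (forall v, v != 0 -> v \in U -> (w v <= w' v)%N) ->
  (mass w U <= mass w' U)%N.
Proof. by move=> ww; rewrite /mass; apply: leq_sum => v /andP[]; apply: ww. Qed.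

Lemma eq_mass w w' U : (forall v, v != 0 -> v \in U -> w v = w' v) -> mass w U = mass w' U.
Proof. by move=> ww; rewrite /mass; apply: eq_bigr => v /andP[]; apply: ww. Qed.

Lemma massD w w' U : mass (fun v => w v + w' v)%N U = (mass w U + mass w' U)%N.
Proof. exact: big_split. Qed.

Lemma mass_sum (I : Type) (r : seq I) (P : pred I) (G : I -> 'rV[F]_m -> nat) U :
  mass (fun v => \sum_(i <- r | P i) G i v)%N U = (\sum_(i <- r | P i) mass (G i) U)%N.
Proof. exact: exchange_big. Qed.

Lemma massS w U W : (U <= W)%VS -> (mass w U <= mass w W)%N.
Proof.
move=> /subvP UW; rewrite /mass [X in (_ <= X)%N]big_mkcond [X in (X <= _)%N]big_mkcond /=.
apply: leq_sum => v _; case: (v == 0) => //=.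
by case: (boolP (v \in U)) => // /UW ->.
Qed.

Lemma mass_eq_scale w U c : mass (fun v => c * w v)%N U = (c * mass w U)%N.
Proof. by rewrite /mass big_distrr. Qed.

(** [vpick] depends only on the line, so each line has exactly one such vector. *)
Definition isrep v := (v != 0) && (vpick <[v]>%VS == v).

Lemma vpick_line v : v != 0 -> isrep (vpick <[v]>%VS) /\ <[vpick <[v]>%VS]>%VS = <[v]>%VS.
Proof.
move=> v0; have r0 : vpick <[v]>%VS != 0 by rewrite vpick0 -dimv_eq0 dim_vline v0.
have E : <[vpick <[v]>%VS]>%VS = <[v]>%VS.
  by apply/eqP; rewrite eqEdim -memvE memv_pick !dim_vline v0 r0.
by rewrite /isrep r0 E eqxx.
Qed.

Lemma mass_line w v : scale_inv w -> v != 0 -> mass w <[v]>%VS = (p.-1 * w v)%N.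
Proof.
move=> wi v0; rewrite (@eq_mass _ (fun=> w v)).
  by rewrite mass_const dim_vline v0 expn1 subn1 mulnC.
by move=> u u0 /vlineP[a E]; rewrite E wi //; apply: contraNneq u0 => a0; rewrite E a0 scale0r.
Qed.

Lemma mass_reps w U : scale_inv w ->
  mass w U = (p.-1 * \sum_(v | isrep v && (v \in U)) w v)%N.
Proof.
move=> wi; rewrite big_distrr /= /mass.
rewrite (partition_big (fun v => vpick <[v]>%VS) (fun r => isrep r && (r \in U))) /=.
  apply: eq_bigr => r /andP[/andP[r0 /eqP rr] rU].
  rewrite -mass_line //; apply: eq_bigl => v.
  have [->|v0] //= := eqVneq v 0; have [_ E] := vpick_line v0.
  apply/andP/idP => [[_ /eqP <-]|]; first by rewrite E memv_line.
  case/vlineP=> a Ea; have a0 : a != 0 by apply: contraNneq v0 => a0; rewrite Ea a0 scale0r.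
  rewrite Ea memvZ //; split=> //; rewrite -{2}rr; apply/eqP; congr (vpick _).
  by apply/eqP; rewrite eqEdim -memvE memvZ ?memv_line // !dim_vline scaler_eq0 (negbTE a0) r0.
move=> v /andP[v0 vU]; have [-> _] := vpick_line v0 => /=.
by have : vpick <[v]>%VS \in <[v]>%VS := memv_pick _; case/vlineP => a ->; rewrite memvZ.
Qed.

Lemma mass_dvd w U : scale_inv w -> (p.-1 %| mass w U)%N.
Proof. by move/mass_reps->; apply: dvdn_mulr. Qed.

Lemma mass_gt_pos w U : (0 < mass w U)%N -> exists v, [/\ v != 0, v \in U & (0 < w v)%N].
Proof.
rewrite lt0n sum_nat_eq0 negb_forall => /existsP[v]; rewrite negb_imply -lt0n.
by case/andP=> /andP[v0 vU] wv; exists v.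
Qed.

Lemma mass_lt_zero w U : (mass w U < p ^ \dim U - 1)%N ->
  exists v, [/\ v != 0, v \in U & w v = 0%N].
Proof.
move=> H; suff : [exists v, [&& v != 0, v \in U & w v == 0%N]].
  by case/existsP=> v /and3P[v0 vU /eqP wv]; exists v.
apply: contraTT H; rewrite negb_exists -leqNgt => /forallP H.
rewrite -[X in (X <= _)%N]mul1n -mass_const; apply: leq_mass => v v0 vU.
by have := H v; rewrite v0 vU /= lt0n.
Qed.

End Mass.

(** * Projection of weights, and blocking conditions on vectors *)

Section Push.

Variables (F : finFieldType) (m d : nat) (g : 'Hom('rV[F]_m, 'rV[F]_d)).
Local Notation p := #|F|.
Implicit Types (w : 'rV[F]_m -> nat) (E : {vspace 'rV[F]_d}).

Definition push w (u : 'rV[F]_d) := (\sum_(v | g v == u) w v)%N.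

Lemma push_scale_inv w : scale_inv w -> scale_inv (push w).
Proof.
move=> wi a u a0; rewrite /push (reindex_onto (fun v => a *: v) (fun v => a^-1 *: v)) /=.
  apply: eq_big => [v|v _]; last exact: wi.
  by rewrite linearZ /= (can_eq (scalerK a0)) scalerK // eqxx andbT.
by move=> v _; rewrite scalerA divff // scale1r.
Qed.

Lemma mass_push w E : (mass (push w) E + mass w (lker g))%N = mass w (g @^-1: E)%VS.
Proof.
rewrite /mass /push [X in (X + _)%N](exchange_big_dep
  (fun v => (g v != 0) && (g v \in E))) /=; last first.
  by move=> u v /andP[u0 uE] /eqP ->; rewrite u0.
rewrite [RHS](bigID (fun v => g v != 0)) /=; congr (_ + _)%N.
  apply: eq_big => [v|v /andP[v0 vE]].
    rewrite -memv_preim; have [->|v0] /= := eqVneq v 0; last by rewrite andbC.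
    by rewrite linear0 eqxx.
  rewrite (big_pred1 (g v)) // => u /=.
  by apply/idP/eqP => [/andP[_ /eqP]|->] //; rewrite v0 vE eqxx.
apply: eq_bigl => v; rewrite negbK -andbA -memv_preim memv_ker.
by have [->|_] := eqVneq (g v) 0; rewrite ?mem0v ?andbF ?andbT.
Qed.

Lemma dim_preim E : limg g = fullv ->
  \dim (g @^-1: E)%VS = (\dim E + \dim (lker g))%N.
Proof.
move=> gT; have := limg_ker_dim g (g @^-1: E).
rewrite lpreimK ?gT ?subvf // addnC => <-; congr (_ + _)%N.
rewrite (_ : (_ :&: _)%VS = lker g) //; apply/capv_idPr.
by apply/subvP => v; rewrite memv_ker -memv_preim => /eqP ->; rewrite mem0v.
Qed.

End Push.

Section Blocking.

Variable F : finFieldType.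
Local Notation p := #|F|.

Lemma quotient_full m d (W : {vspace 'rV[F]_m}) (g : 'Hom('rV[F]_m, 'rV[F]_d)) :
  (\dim W + d = m)%N -> lker g = W -> limg g = fullv.
Proof.
move=> dW kW; apply/eqP; rewrite eqEdim subvf dim_rV /=.
have := limg_ker_dim g fullv; rewrite capfv kW dim_rV => E.
by rewrite -(leq_add2l (\dim W)) E dW.
Qed.

Lemma dim_quotient_line m d (W : {vspace 'rV[F]_m}) (g : 'Hom('rV[F]_m, 'rV[F]_d)) u :
  (\dim W + d = m)%N -> lker g = W -> u != 0 -> \dim (g @^-1: <[u]>)%VS = (\dim W).+1.
Proof.
by move=> dW kW u0; rewrite dim_preim ?(quotient_full dW) // kW dim_vline u0.
Qed.

Lemma mass_quotient_line m d (w : 'rV[F]_m -> nat) (W : {vspace 'rV[F]_m})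
    (g : 'Hom('rV[F]_m, 'rV[F]_d)) u : scale_inv w ->
  lker g = W -> u != 0 ->
  mass w (g @^-1: <[u]>)%VS = (p.-1 * push g w u + mass w W)%N.
Proof.
by move=> wi kW u0; rewrite -mass_push kW mass_line //; apply: push_scale_inv.
Qed.

Variable m : nat.
Implicit Types (w : 'rV[F]_m -> nat) (U : {vspace 'rV[F]_m}) (k t : nat).

Definition blocks k t w := forall U, (\dim U + k = m)%N -> (t * p.-1 <= mass w U)%N.

(** The bound (t + 1/2) p^k - 1/2 on the number of points, multiplied by 2 to clear denominators and
    by p - 1 because of [mass]. *)
Definition small k t w := (2 * mass w fullv <= p.-1 * ((2 * t + 1) * p ^ k - 1))%N.

(** On a subspace with exactly t points any loss of weight violates [blocks]; minimality puts every
    point of the support on such a subspace. *)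
Definition minimal k t w := forall v, v != 0 -> (0 < w v)%N ->
  exists U, [/\ v \in U, (\dim U + k = m)%N & mass w U = (t * p.-1)%N].

Definition pts w U := (\sum_(v | isrep v && (v \in U)) w v)%N.

Lemma pts_mass w U : scale_inv w -> mass w U = (p.-1 * pts w U)%N.
Proof. exact: mass_reps. Qed.

Lemma leq_pts w U U' : (U <= U')%VS -> (pts w U <= pts w U')%N.
Proof.
move=> /subvP UU; rewrite /pts [X in (_ <= X)%N]big_mkcond [X in (X <= _)%N]big_mkcond.
apply: leq_sum => v _ /=; case: (isrep v) => //=.
by case: (boolP (v \in U)) => // /UU ->.
Qed.

Lemma p1_gt0 : (0 < p.-1)%N.
Proof. by have := card_gt1 F; case: p => [|[|]]. Qed.

Lemma pts_blocks k t w U : scale_inv w -> blocks k t w -> (\dim U + k = m)%N ->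
  (t <= pts w U)%N.
Proof. by move=> wi /[apply]; rewrite pts_mass // mulnC leq_pmul2l // p1_gt0. Qed.

Lemma pts_small k t w : scale_inv w -> small k t w ->
  (2 * pts w fullv + 1 <= (2 * t + 1) * p ^ k)%N.
Proof.
move=> wi; rewrite /small pts_mass // mulnCA leq_pmul2l ?p1_gt0 //.
have : (0 < p ^ k)%N by rewrite expn_gt0 (ltnW (card_gt1 F)).
by move: (p ^ k)%N (pts _ _) => a b; nia.
Qed.

End Blocking.

(** * Lines of PG(k+1,p) *)

Section Functionals.

Variables (p k : nat) (L : finFieldType).
Hypotheses (p_prime : prime p) (k_gt0 : (0 < k)%N) (chL : p \in [pchar L]).
Hypothesis (cardL : #|L| = (p ^ k)%N).
Local Notation V := 'rV['F_p]_k.+2.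
Local Notation E := (pPrimeCharType chL).

Definition extend (b : V) : 'rV[L]_k.+2 := \row_j (b 0 j : nat)%:R.

Definition value (x : 'I_k.+2 -> L) (b : V) : E := \sum_j b 0 j *: (x j : E).

Lemma value_linear x : linear (value x).
Proof.
move=> c u v; rewrite /value scaler_sumr -big_split; apply: eq_bigr => j _ /=.
by rewrite !mxE scalerDl scalerA.
Qed.
HB.instance Definition _ x := GRing.isLinear.Build _ _ _ _ (value x) (value_linear x).

Definition functional x : 'Hom(V, E) := linfun (value x).

Lemma dot_extend x b : dot (extend b) x = functional x b.
Proof. by rewrite lfunE /=; apply: eq_bigr => j _; rewrite mxE. Qed.

Lemma dim_L : \dim {: E} = k.
Proof. by rewrite pprimeChar_dimf cardL pfactorK. Qed.

Lemma dim_functional x : (2 <= \dim (lker (functional x)))%N.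
Proof.
have := limg_ker_dim (functional x) fullv; rewrite capfv dim_rV => H.
have := dimvS (subvf (limg (functional x))); rewrite dim_L.
move: H; move: (\dim _) (\dim _) => a b; lia.
Qed.

(** The quotient by U and the field L both have dimension k over the prime field. *)
Lemma exists_functional (U : {vspace V}) : \dim U = 2%N ->
  exists x, lker (functional x) = U.
Proof.
move=> dU; have [|g kg] := @exists_quotient _ _ k U; first by rewrite dU.
have [h [kh _]] := @exists_embedding _ E k fullv dim_L.
exists (fun j => h (g (delta_mx 0 j))); apply/vspaceP => v.
rewrite -kg [RHS]memv_ker memv_ker.
have -> : functional (fun j => h (g (delta_mx 0 j))) v = h (g v).
  rewrite [LHS]lfunE /= [in RHS](row_sum_delta v) !linear_sum; apply: eq_bigr => j _ /=.
  by rewrite !linearZ.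
by rewrite -(memv_ker h) kh memv0.
Qed.

Variable w : V -> nat.
Hypothesis wi : scale_inv w.

Definition pointseq := flatten [seq nseq (if isrep v then w v else 0%N) v | v <- enum {: V}].

Definition extseq := [seq extend v | v <- pointseq].

Lemma count_pointseq (P : pred V) : count P pointseq = (\sum_(v | isrep v && P v) w v)%N.
Proof.
rewrite count_flatten -map_comp sumnE big_map big_enum /= [RHS]big_mkcond /=.
apply: eq_bigr => v _; rewrite count_nseq; case: (isrep v); rewrite ?muln0 //=.
by case: (P v); rewrite ?mul1n.
Qed.

Lemma hcount_extseq x : hcount extseq x = pts w (lker (functional x)).
Proof.
rewrite /hcount count_map count_pointseq; apply: eq_bigl => v /=.
by rewrite dot_extend memv_ker.
Qed.

Lemma size_extseq : size extseq = pts w fullv.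
Proof.
rewrite size_map -count_predT count_pointseq; apply: eq_bigl => v.
by rewrite memvf.
Qed.

Lemma mem_extseq b : b \in extseq ->
  exists v, [/\ v != 0, (0 < w v)%N & b = extend v].
Proof.
case/mapP=> v /flatten_mapP[u _]; rewrite mem_nseq.
case ru : (isrep u) => //= /andP[wu /eqP ->] ->; exists u; split=> //.
by case/andP: ru.
Qed.

Lemma extend_neq0 v : v != 0 -> extend v != 0.
Proof.
apply: contra => /eqP ev; apply/eqP/rowP => j.
have /rowP/(_ j) := ev; rewrite !mxE => /eqP; rewrite -(dvdn_pcharf chL) => d.
apply/val_inj => /=; apply/eqP; move: d; rewrite /dvdn.
by rewrite modn_small // (leq_trans (ltn_ord _)) // Fp_cast.
Qed.

End Functionals.

(** U' provides the direction e and U the base point x0; the absence of a common point of positive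
    weight is precisely the genericity of x0. *)
Theorem skew_line_mod (p k t : nat) (w : 'rV['F_p]_k.+2 -> nat)
    (U U' : {vspace 'rV['F_p]_k.+2}) :
  prime p -> (0 < k)%N -> (0 < t)%N -> scale_inv w -> blocks k t w -> small k t w ->
  minimal k t w -> \dim U = 2%N -> \dim U' = 2%N -> pts w U' = t ->
  (forall v, v != 0 -> v \in U -> v \in U' -> w v = 0%N) ->
  (p %| pts w U - t)%N.
Proof.
move=> pr_p k0 t0 wi wB wS wM dU dU' nU' UU'.
have [L chL cardL] := pPrimePowerField pr_p k0.
have dimU (W : {vspace 'rV['F_p]_k.+2}) : \dim W = 2%N -> (\dim W + k = k.+2)%N by move=> ->.
have [x kx] := exists_functional pr_p chL cardL dU.
have [e ke] := exists_functional pr_p chL cardL dU'.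
have p1 : (0 < #|'F_p|.-1)%N by apply: p1_gt0.
rewrite -kx -(hcount_extseq chL w x); apply: (@hcount_mod L k.+2 t p _ chL t0 _ _ _ _ e).
- by move=> b /mem_extseq[v [v0 _ ->]]; apply: extend_neq0.
- move=> y j _; rewrite hcount_extseq.
  have [W WK dW] := exists_subspace (dim_functional pr_p k0 chL cardL y).
  by apply: leq_trans (leq_pts w WK); apply: pts_blocks wB (dimU _ dW).
- by rewrite size_extseq cardL; have := pts_small wi wS; rewrite card_Fp.
- move=> b /mem_extseq[v [v0 wv ->]]; have [W [vW dW mW]] := wM v v0 wv.
  have dW2 : \dim W = 2%N by apply: (@addIn k); rewrite dW.
  have [y ky] := exists_functional pr_p chL cardL dW2.
  exists y; split.
  + apply/existsP; rewrite -negb_forall; apply/negP => /forallP y0.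
    have : lker (functional chL y) = fullv.
      apply/vspaceP => u; rewrite memvf memv_ker lfunE /=; apply/eqP.
      by apply: big1 => j _; rewrite (eqP (y0 j)) scaler0.
    by rewrite ky => /(congr1 (fun W => \dim W)); rewrite dW2 dim_rV; case: (k) k0.
  + by rewrite (dot_extend chL); have := vW; rewrite -ky memv_ker => /eqP.
  + rewrite hcount_extseq ky; apply/eqP.
    by rewrite -(eqn_pmul2l p1) -pts_mass // mW mulnC.
- by rewrite hcount_extseq ke.
- apply/allP => b /mem_extseq[v [v0 wv ->]]; apply/implyP.
  rewrite !(dot_extend chL) => ve; have vU' : v \in U' by rewrite -ke memv_ker.
  apply: contraL wv => vx; have vU : v \in U by rewrite -kx memv_ker.
  by rewrite -leqNgt (UU' v).
Qed.

(** * Lines through points of weight zero in PG(k+1,p) *)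

Lemma nat_Cauchy_Schwarz (I : finType) (Z : pred I) (a : I -> nat) :
  ((\sum_(i | Z i) a i) ^ 2 <= #|Z| * \sum_(i | Z i) a i ^ 2)%N.
Proof.
rewrite -(leq_pmul2l (isT : (0 < 2)%N)) expnS expn1 big_distrlr /=.
have -> : (2 * (#|Z| * \sum_(i | Z i) a i ^ 2) =
    \sum_(i | Z i) \sum_(j | Z j) (a i ^ 2 + a j ^ 2))%N.
  under [RHS]eq_bigr => i _ do rewrite big_split /= sum_nat_const.
  by rewrite big_split /= sum_nat_const -big_distrr /= mul2n addnn.
rewrite big_distrr; apply: leq_sum => i _ /=; rewrite big_distrr.
by apply: leq_sum => j _ /=; apply: (nat_Cauchy _ _).1.
Qed.

Lemma zero_arith (p q t N : nat) : (1 < p)%N -> (0 < q)%N -> (t < p)%N ->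
  (2 * N <= p.-1 * ((2 * t + 1) * q - 1))%N -> (N < p * (p * q) - 1)%N.
Proof. by case: p => [|[|a]] //= _ q0 tp; nia. Qed.

(** A k-subspace has mass p q - 1 with q = p^k. In this form the size bound limits the excess of N
    over t of them to (p-1)(q-1)/2 - t(q-1). *)
Lemma excess_arith (p q t N : nat) : (1 < p)%N -> (0 < q)%N ->
  (2 * N <= p.-1 * ((2 * t + 1) * q - 1))%N ->
  (2 * N + 2 * t * (q - 1) <= 2 * t * (p * q - 1) + (p - 1) * (q - 1))%N.
Proof. by case: p => [|[|a]] //= _; case: q => // q _; nia. Qed.

Lemma bad_arith1 (p j : nat) : (1 < p)%N -> (0 < j)%N ->
  (2 * (p ^ 2 - 1) <= p ^ 2 - 1 + (j - 1) * (p - 1))%N -> (p.+2 <= j)%N.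
Proof. by case: p => [|[|p]] //= _; nia. Qed.

(** After cancellation the inequality becomes j (p + 1) <= t (p + j), but p + j < 2j and 2t < p. *)
Lemma bad_arith2 (p t j : nat) : (1 < p)%N -> (2 * t < p)%N -> (p.+2 <= j)%N ->
  ~ ((j * (p ^ 2 - 1)) ^ 2 <= t * (p ^ 2 - 1) * (j * (p ^ 2 - 1 + (j - 1) * (p - 1))))%N.
Proof.
case: p => [|a] // a0 ta ja; have -> : (a.+1 ^ 2 - 1 = a * a.+2)%N by nia.
have -> : (a * a.+2 + (j - 1) * (a.+1 - 1) = a * (a + j + 1))%N by nia.
have -> : ((j * (a * a.+2)) ^ 2 = a * a.+2 * j * a * (j * a.+2))%N by nia.
have -> : (t * (a * a.+2) * (j * (a * (a + j + 1))) = a * a.+2 * j * a * (t * (a + j + 1)))%N.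
  by nia.
rewrite leq_pmul2l ?muln_gt0; last by lia.
by nia.
Qed.

Section Pencils.

Variable F : finFieldType.
Local Notation p := #|F|.

Lemma mass_const_full d c :
  mass (fun=> c) (fullv : {vspace 'rV[F]_d}) = (c * (p ^ d - 1))%N.
Proof. by rewrite mass_const dim_rV. Qed.

Lemma mass_full_lower d (c : 'rV[F]_d -> nat) t (E : {vspace 'rV[F]_d}) :
  (forall u, u != 0 -> (t <= c u)%N) ->
  (mass c E + t * (p ^ d - p ^ \dim E) <= mass c fullv)%N.
Proof.
move=> tc; pose c' u := (c u - t)%N.
have cE W : mass c W = (t * (p ^ \dim W - 1) + mass c' W)%N.
  rewrite -mass_const -massD; apply: eq_mass => u u0 _.
  by rewrite subnKC // tc.
have pE : (p ^ \dim E <= p ^ d)%N.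
  by rewrite leq_exp2l ?card_gt1 //; have := dimvS (subvf E); rewrite dim_rV.
have p0 : (0 < p ^ \dim E)%N by rewrite expn_gt0 (ltnW (card_gt1 F)).
rewrite (cE E) (cE fullv) dim_rV addnAC -mulnDr.
have -> : (p ^ \dim E - 1 + (p ^ d - p ^ \dim E) = p ^ d - 1)%N.
  by move: pE p0; move: (p ^ _)%N (p ^ _)%N => a b; lia.
by rewrite leq_add2l massS // subvf.
Qed.

Variable k : nat.
Local Notation V := 'rV[F]_k.+2.

Section Hyps.

Variables (t : nat) (w : V -> nat).
Hypotheses (k_gt0 : (0 < k)%N) (tp : (t < p)%N) (wi : scale_inv w).
Hypotheses (wB : blocks k t w) (wS : small k t w).

Let q_gt0 : (0 < p ^ k)%N.
Proof. by rewrite expn_gt0 (ltnW (card_gt1 F)). Qed.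

Lemma dim_line (Q : V) : Q != 0 -> (\dim <[Q]> + k.+1 = k.+2)%N.
Proof. by move=> Q0; rewrite dim_vline Q0. Qed.

Lemma exists_zero : exists2 Q, Q != 0 & w Q = 0%N.
Proof.
have [|Q [Q0 _ wQ]] := @mass_lt_zero F _ w fullv; last by exists Q.
rewrite dim_rV !expnS; apply: zero_arith wS => //; exact: card_gt1.
Qed.

Section Quotient.

Variables (Q : V) (g : 'Hom(V, 'rV[F]_k.+1)).
Hypotheses (Q_neq0 : Q != 0) (kerg : lker g = <[Q]>%VS).

Lemma quotient_line u : u != 0 -> \dim (g @^-1: <[u]>)%VS = 2%N.
Proof. by move=> u0; rewrite (dim_quotient_line (dim_line Q_neq0)) // dim_vline Q_neq0. Qed.

Lemma pts_quotient_line u : u != 0 -> pts w (g @^-1: <[u]>)%VS = (push g w u + w Q)%N.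
Proof.
move=> u0; apply/eqP; rewrite -(eqn_pmul2l (p1_gt0 F)) -pts_mass //.
by rewrite (mass_quotient_line wi kerg) // mass_line // mulnDr.
Qed.

Lemma push_lower u : u != 0 -> (t <= push g w u + w Q)%N.
Proof.
move=> u0; rewrite -pts_quotient_line //; apply: pts_blocks wB _ => //.
by rewrite quotient_line.
Qed.

Lemma mass_quotient (E : {vspace 'rV[F]_k.+1}) :
  (mass (push g w) E + p.-1 * w Q = mass w (g @^-1: E)%VS)%N.
Proof. by rewrite -mass_push kerg mass_line. Qed.

Lemma mass_quotient_full : (mass (push g w) fullv + p.-1 * w Q = mass w fullv)%N.
Proof.
rewrite mass_quotient; congr (mass w _); apply/vspaceP => v.
by rewrite memvf -memv_preim memvf.
Qed.

Lemma preim_image_line (U : {vspace V}) v : v \in U -> g v != 0 -> Q \in U ->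
  \dim U = 2%N -> U = (g @^-1: <[g v]>)%VS.
Proof.
move=> vU gv0 QU dU; apply/esym/eqP; rewrite eqEdim quotient_line // dU leqnn andbT.
apply/subvP => x; rewrite -memv_preim => /vlineP[a E].
have : x - a *: v \in lker g by rewrite memv_ker linearB linearZ /= E subrr.
rewrite kerg => /vlineP[b Eb]; rewrite -(subrK (a *: v) x) Eb.
by rewrite memvD ?memvZ.
Qed.

Lemma exists_off (U : {vspace V}) : Q \in U -> \dim U = 2%N -> exists2 v, v \in U & g v != 0.
Proof.
move=> QU dU; apply/exists_inP; apply: contraT; rewrite negb_exists_in => /forall_inP H.
have : (U <= <[Q]>)%VS.
  by apply/subvP => v /H; rewrite negbK -memv_ker kerg.
by move/dimvS; rewrite dU dim_vline Q_neq0.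
Qed.

End Quotient.

Lemma exists_quotient_point (Q : V) : Q != 0 ->
  exists g : 'Hom(V, 'rV[F]_k.+1), lker g = <[Q]>%VS.
Proof. by move=> Q0; apply: exists_quotient; apply: dim_line. Qed.

Lemma mass_excess : (2 * mass w fullv + 2 * t * (p ^ k - 1) <=
   2 * t * (p ^ k.+1 - 1) + (p - 1) * (p ^ k - 1))%N.
Proof. by rewrite expnS; apply: excess_arith => //; apply: card_gt1. Qed.

Lemma zero_lower : (t * (p ^ k.+1 - 1) <= mass w fullv)%N.
Proof.
have [Q Q0 wQ] := exists_zero; have [g kg] := exists_quotient_point Q0.
rewrite -(mass_quotient_full Q0 kg) wQ muln0 addn0.
rewrite -mass_const_full; apply: leq_mass => u u0 _.
by have := push_lower Q0 kg u0; rewrite wQ addn0.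
Qed.

(** The lower bound from the lines through a zero-weight point must not exceed the upper bound of
    [mass_excess]. *)
Lemma double_t_lt : (2 * t < p)%N.
Proof.
have pq : (p <= p ^ k)%N by rewrite -{1}[p]expn1 leq_exp2l ?card_gt1.
have q1 : (0 < p ^ k - 1)%N by rewrite subn_gt0 (leq_trans (card_gt1 F)).
have : (2 * t * (p ^ k - 1) <= (p - 1) * (p ^ k - 1))%N.
  have := mass_excess; have := zero_lower; rewrite -!(mulnA 2).
  move: (mass _ _) (t * (_ - _))%N (t * (_ - _))%N ((_ - _) * _)%N => a b c d; lia.
by rewrite leq_pmul2r //; have := card_gt1 F; lia.
Qed.

(** If all lines through Q outside E had t + 1 points, the excess over t k-subspaces would be at
    least (p - 1) q, more than twice what [mass_excess] permits. *)
Lemma exists_secant (Q : V) (g : 'Hom(V, 'rV[F]_k.+1)) (E : {vspace 'rV[F]_k.+1}) :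
  Q != 0 -> lker g = <[Q]>%VS -> w Q = 0%N -> (\dim E <= k)%N ->
  exists2 u, u \notin E & push g w u = t.
Proof.
move=> Q0 kg wQ dE.
have [/exists_inP[u uE /eqP gu]|] := boolP [exists (u | u \notin E), push g w u == t].
  by exists u.
rewrite negb_exists_in => /forall_inP H; exfalso.
have : ((t.+1) * (p ^ k.+1 - 1) <= mass (push g w) fullv + (p ^ \dim E - 1))%N.
  have -> : (p ^ \dim E - 1 = mass (fun v => (v \in E) : nat) fullv)%N.
    by rewrite mass_indicator capfv.
  rewrite -massD -mass_const_full; apply: leq_mass => u u0 _.
  have tu : (t <= push g w u)%N by have := push_lower Q0 kg u0; rewrite wQ addn0.
  have [uE|uE] := boolP (u \in E); first by rewrite addn1 ltnS.
  by rewrite addn0 ltn_neqAle tu eq_sym H.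
have pE : (p ^ \dim E <= p ^ k)%N by rewrite leq_exp2l ?card_gt1.
have := mass_excess; rewrite -(mass_quotient_full Q0 kg) wQ muln0 addn0 expnS.
have := card_gt1 F; move: q_gt0 pE; move: (mass _ _) => N.
move: (p ^ \dim E)%N (p ^ k)%N => e q; move: p => P q0 eq P1; nia.
Qed.

Hypothesis t_gt0 : (0 < t)%N.
Hypothesis skew_mod : forall U U' : {vspace V}, \dim U = 2%N -> \dim U' = 2%N ->
  pts w U' = t -> (forall v, v != 0 -> v \in U -> v \in U' -> w v = 0%N) ->
  (p %| pts w U - t)%N.

(** A t-secant through Q other than U meets U only in Q, whose weight is zero, so [skew_mod]
    applies. *)
Lemma line_mod_zero (U : {vspace V}) Q : \dim U = 2%N -> Q != 0 -> Q \in U -> w Q = 0%N ->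
  (p %| pts w U - t)%N.
Proof.
move=> dU Q0 QU wQ; have [g kg] := exists_quotient_point Q0.
have d0 : (\dim (0%VS : {vspace 'rV[F]_k.+1}) <= k)%N by rewrite dimv0.
have [u] := exists_secant Q0 kg wQ d0; rewrite memv0 => u0 gu; set U' := (g @^-1: <[u]>)%VS.
have dU' : \dim U' = 2%N by apply: quotient_line Q0 kg _ u0.
have nU' : pts w U' = t by rewrite (pts_quotient_line Q0 kg) // gu wQ addn0.
have [->|UU'] := eqVneq U U'; first by rewrite nU' subnn.
apply: (skew_mod dU dU' nU') => v v0 vU vU'.
have [gv|gv] := eqVneq (g v) 0.
  have : v \in <[Q]>%VS by rewrite -kg memv_ker gv.
  case/vlineP=> a va; rewrite va wi //.
  by apply: contraNneq v0 => a0; rewrite va a0 scale0r.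
case/eqP: UU'; rewrite (preim_image_line Q0 kg vU gv QU dU).
congr (_ @^-1: _)%VS; apply/eqP; rewrite eqEdim -memvE !dim_vline gv u0 andbT.
by rewrite memv_preim.
Qed.

(** A line without zero-weight point is projected from a zero-weight point Q off it. Its image has
    dimension at most 2 <= k, so some t-secant through Q avoids the image and is skew to the
    line. *)
Lemma line_mod_nonplanar (U : {vspace V}) : (1 < k)%N -> \dim U = 2%N -> (p %| pts w U - t)%N.
Proof.
move=> k1 dU.
have [/existsP[Q /and3P[Q0 QU /eqP wQ]]|/existsPn nz] :=
  boolP [exists Q, [&& Q != 0, Q \in U & w Q == 0%N]]; first exact: line_mod_zero dU Q0 QU wQ.
have [Q Q0 wQ] := exists_zero; have [g kg] := exists_quotient_point Q0.
have QU : Q \notin U by have := nz Q; rewrite Q0 wQ eqxx andbT.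
have dE : (\dim (g @: U) <= k)%N.
  have := leq_addl (\dim (U :&: lker g)) (\dim (g @: U)).
  by rewrite limg_ker_dim dU => /leq_trans; apply.
have [u uE gu] := exists_secant Q0 kg wQ dE.
have u0 : u != 0 by apply: contraNneq uE => ->; rewrite mem0v.
apply: (skew_mod dU (quotient_line Q0 kg u0)).
  by rewrite (pts_quotient_line Q0 kg) // gu wQ addn0.
move=> v v0 vU; rewrite -memv_preim => /vlineP[a gv].
have a0 : a = 0.
  apply/eqP; apply: contraNT uE => a0.
  have -> : u = a^-1 *: g v by rewrite gv scalerA mulVf ?scale1r.
  by rewrite memvZ // memv_img.
have : v \in <[Q]>%VS by rewrite -kg memv_ker gv a0 scale0r.
case/vlineP=> b vb; case/negP: QU; have b0 : b != 0.
  by apply: contraNneq v0 => b0; rewrite vb b0 scale0r.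
by rewrite -[Q](scalerK b0) -vb memvZ.
Qed.

(** In a plane the other lines through Q already use up so much of the size that U has c points with
    2c < p; together with c >= t and c = t mod p this forces c = t. *)
Lemma line_secant_zero (U : {vspace V}) Q : k = 1%N ->
  \dim U = 2%N -> Q != 0 -> Q \in U -> w Q = 0%N -> pts w U = t.
Proof.
move=> k1 dU Q0 QU wQ; have [g kg] := exists_quotient_point Q0.
have [v vU gv] := exists_off Q0 kg QU dU.
have lc u : u != 0 -> (t <= push g w u)%N.
  by move=> u0; have := push_lower Q0 kg u0; rewrite wQ addn0.
have := line_mod_zero dU Q0 QU wQ; rewrite (preim_image_line Q0 kg vU gv QU dU).
rewrite (pts_quotient_line Q0 kg) // wQ addn0.
have := mass_full_lower <[g v]>%VS lc.
have := mass_excess; rewrite -(mass_quotient_full Q0 kg) wQ muln0 addn0.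
rewrite mass_line ?dim_vline ?gv //; last exact: push_scale_inv.
have := lc _ gv; have := card_gt1 F.
move: (mass _ _) (push _ _ _) => N c; rewrite k1 !expnS expn0 !muln1.
move=> P1 tc H1 H2 /dvdnP[e E]; have cE : c = (e * p + t)%N by lia.
suff : (2 * c < p)%N by move: cE; case: e E => [|e] _; nia.
move: H1 H2; rewrite {E cE}; case: p P1 => [|[|b]] // _.
have -> : (b.+2 * b.+2 - 1 = b.+1 * b.+3)%N by lia.
have -> : (b.+2 * b.+2 - b.+2 = b.+1 * b.+2)%N by lia.
rewrite subn1 /= => H1 H2; rewrite ltnS -(leq_pmul2l (ltn0Sn b)); lia.
Qed.

Lemma plane_mass : k = 1%N -> mass w fullv = (t * (p ^ 2 - 1))%N.
Proof.
move=> k1; have [Q Q0 wQ] := exists_zero; have [g kg] := exists_quotient_point Q0.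
rewrite -(mass_quotient_full Q0 kg) wQ muln0 addn0.
rewrite (@eq_mass _ _ _ (fun=> t)) ?mass_const_full ?k1 // => u u0 _.
have := pts_quotient_line Q0 kg u0; rewrite wQ addn0 => <-.
apply: (line_secant_zero k1 (quotient_line Q0 kg u0) Q0) => //.
have : Q \in lker g by rewrite kg memv_line.
by rewrite -memv_preim memv_ker => /eqP ->; rewrite mem0v.
Qed.

(* For [k = 1]: a bad line lies in the support, and each of its points is on a
   second bad line, so there are at least [p + 2] of them.  Cauchy-Schwarz for
   the number of bad lines through a point contradicts the size of the support. *)
Definition bad_lines := [set U : {vspace V} | (\dim U == 2) && ~~ (p %| pts w U - t)%N].

Lemma bad_line_support U v : U \in bad_lines -> v != 0 -> v \in U -> (0 < w v)%N.
Proof.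
rewrite inE => /andP[/eqP dU bU] v0 vU; rewrite lt0n; apply: contra bU => /eqP.
exact: line_mod_zero.
Qed.

(** Summed over all lines through v, the excess over t is p w(v) by [plane_mass], hence divisible by
    p; so it cannot fail to be divisible on one line only. *)
Lemma second_bad_line U v : k = 1%N -> U \in bad_lines -> v != 0 -> v \in U ->
  exists U', [/\ U' \in bad_lines, U' != U & v \in U'].
Proof.
move=> k1 bU v0 vU.
have [/existsP[U' /and3P[]]|/existsPn H] :=
  boolP [exists U', [&& U' \in bad_lines, U' != U & v \in U']]; first by exists U'.
move: (bU); rewrite inE => /andP[/eqP dU /negP[]].
have [g kg] := exists_quotient_point v0; have [v' vU' gv'] := exists_off v0 kg vU dU.
pose W u := (push g w u + w v - t)%N.
have WE u : u != 0 -> W u = (pts w (g @^-1: <[u]>)%VS - t)%N.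
  by move=> u0; rewrite (pts_quotient_line v0 kg).
have Wi : scale_inv W by move=> a u a0; rewrite /W push_scale_inv.
have WT : (mass W fullv + t * (p ^ 2 - 1) = mass (push g w) fullv + w v * (p ^ 2 - 1))%N.
  have -> : (p ^ 2 = p ^ k.+1)%N by rewrite k1.
  rewrite -!mass_const_full -!massD; apply: eq_mass => u u0 _.
  by rewrite subnK // (push_lower v0 kg).
have dW : (p %| mass W fullv)%N.
  have := WT; rewrite -plane_mass // -(mass_quotient_full v0 kg).
  rewrite addnCA => /addnI E; have : (mass W fullv = p * (p.-1 * w v))%N.
    move: E; move: (mass _ _) (w v) => M x; case: p (card_gt1 F) => [|P] //= _; nia.
  by move=> ->; apply: dvdn_mulr.
have d1 : (p %| mass W <[g v']>%VS)%N.
  move: dW; rewrite {1}/mass (bigID (fun u => u \in <[g v']>%VS)) /= dvdn_addl.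
    by congr (_ %| _)%N; apply: eq_bigl => u; rewrite memvf andbT.
  apply: dvdn_sum => u /andP[/andP[u0 _] uU]; rewrite WE //.
  set U' := (g @^-1: <[u]>)%VS; have := H U'; rewrite !negb_and !negbK.
  have -> : v \in U'.
    have : v \in lker g by rewrite kg memv_line.
    by rewrite -memv_preim memv_ker => /eqP ->; rewrite mem0v.
  rewrite orbF inE (quotient_line v0 kg u0) eqxx /= negbK => /orP[//|/eqP E].
  case/negP: uU; have : g v' \in <[u]>%VS by rewrite memv_preim -/U' E.
  case/vlineP=> a Ea; have a0 : a != 0 by apply: contraNneq gv' => a0; rewrite Ea a0 scale0r.
  by rewrite Ea -{1}[u](scalerK a0) memvZ // memv_line.
move: d1; rewrite mass_line // Gauss_dvdr.
  by rewrite WE // -(preim_image_line v0 kg vU' gv' vU dU).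
by rewrite -[X in coprime X _](prednK (ltnW (card_gt1 F))) coprimeSn.
Qed.

Lemma no_bad_lines : k = 1%N -> bad_lines = set0.
Proof.
move=> k1; apply/eqP; apply/set0Pn => -[U0 bU0].
pose J := #|bad_lines|; pose d v := (\sum_(U in bad_lines) (v \in U))%N.
have P1 := card_gt1 F.
have J0 : (0 < J)%N by apply/card_gt0P; exists U0.
have dim2 U : U \in bad_lines -> \dim U = 2%N by rewrite inE => /andP[/eqP].
have mdU U : U \in bad_lines -> mass d U = (p ^ 2 - 1 + (J - 1) * (p - 1))%N.
  move=> bU; rewrite mass_sum (bigD1 U) //= mass_indicator capvv dim2 //; congr (_ + _)%N.
  rewrite (eq_bigr (fun=> (p - 1)%N)) => [|U' /andP[bU' ne]].
    rewrite sum_nat_const; congr (_ * _)%N.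
    rewrite /J (cardsD1 U) bU addnC addnK; apply: eq_card => U1.
    by rewrite in_setD1 andbC.
  rewrite mass_indicator; suff -> : \dim (U :&: U') = 1%N by rewrite expn1.
  have := dimv_sum_cap U U'; rewrite (dim2 U bU) (dim2 U' bU').
  have : (\dim (U + U') <= 3)%N.
    by have := dimvS (subvf (U + U')); rewrite dim_rV => /leq_trans; apply; rewrite k1.
  have : (\dim (U :&: U') < 2)%N.
    rewrite ltnNge -{1}(dim2 U bU); apply: contra ne => le.
    have E : (U :&: U')%VS = U by apply/eqP; rewrite eqEdim capvSl.
    by apply/eqP/esym/eqP; rewrite eqEdim (dim2 U bU) (dim2 U' bU') andbT -E capvSr.
  move: (\dim _) (\dim _) => a b; lia.
have d2 U v : U \in bad_lines -> v != 0 -> v \in U -> (2 <= d v)%N.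
  move=> bU v0 vU; have [U' [bU' ne vU']] := second_bad_line k1 bU v0 vU.
  by rewrite /d (bigD1 U) //= (bigD1 U') ?bU' //= vU vU'.
have J2 : (p.+2 <= J)%N.
  have : (2 * (p ^ 2 - 1) <= mass d U0)%N.
    have := mass_const 2 U0; rewrite (dim2 U0 bU0) => <-.
    by apply: leq_mass => v v0 vU; apply: d2 bU0 v0 vU.
  by rewrite mdU //; apply: bad_arith1.
pose Z := [pred v : V | (v != 0) && (0 < d v)%N].
have sumZ (h : V -> nat) : (forall v, d v = 0%N -> h v = 0%N) ->
    (\sum_(v | Z v) h v = mass h fullv)%N.
  move=> h0; rewrite /mass [LHS]big_mkcond [RHS]big_mkcond; apply: eq_bigr => v _ /=.
  by rewrite memvf andbT; case: (v != 0) => //=; case: posnP => // /h0 ->.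
have cZ : (#|Z| <= t * (p ^ 2 - 1))%N.
  rewrite -plane_mass // -sum1_card /mass big_mkcond [X in (_ <= X)%N]big_mkcond /=.
  apply: leq_sum => v _; rewrite memvf andbT !inE; case: eqVneq => //= v0.
  case: ifP => //; rewrite lt0n sum_nat_eq0 negb_forall => /existsP[U].
  rewrite negb_imply eqb0 negbK => /andP[bU vU].
  exact: bad_line_support bU v0 vU.
have := nat_Cauchy_Schwarz Z d; rewrite !sumZ //; last by move=> v ->.
have -> : mass d fullv = (J * (p ^ 2 - 1))%N.
  rewrite mass_sum (eq_bigr (fun=> (p ^ 2 - 1)%N)) ?sum_nat_const // => U bU.
  by rewrite mass_indicator capfv dim2.
(* Summing d over the points of each bad line counts every point d(v) times. *)
have -> : mass (fun v => d v ^ 2)%N fullv = (J * (p ^ 2 - 1 + (J - 1) * (p - 1)))%N.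
  transitivity (\sum_(U in bad_lines) mass d U)%N; last first.
    by rewrite (eq_bigr _ mdU) sum_nat_const.
  transitivity (\sum_(U in bad_lines) mass (fun v => ((v \in U) * d v)%N) fullv)%N.
    rewrite -mass_sum; apply: eq_mass => v _ _; rewrite -big_distrl /=.
    by rewrite expnS expn1.
  apply: eq_bigr => U _; rewrite /mass [LHS]big_mkcond [RHS]big_mkcond.
  apply: eq_bigr => v _ /=.
  by rewrite memvf andbT; case: (v != 0) => //=; case: (v \in U); rewrite ?mul1n.
move=> C; apply: (bad_arith2 P1 double_t_lt J2).
exact: leq_trans C (leq_mul cZ (leqnn _)).
Qed.

Theorem line_mod (U : {vspace V}) : \dim U = 2%N -> (p %| pts w U - t)%N.
Proof.
move=> dU; case: (ltngtP k 1) => [k0|k1|k1]; first by move: k0; rewrite ltnS leqNgt k_gt0.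
  exact: line_mod_nonplanar.
apply: contraT => bU; have : U \in bad_lines by rewrite inE dU eqxx.
by rewrite no_bad_lines // inE.
Qed.

End Hyps.
End Pencils.

(** * Decomposition in PG(k+1,p) *)

Section Packings.

Variable F : finFieldType.
Local Notation p := #|F|.

Section Remove.

Variable m : nat.
Implicit Types (w : 'rV[F]_m -> nat) (U S : {vspace 'rV[F]_m}) (ss : seq {vspace 'rV[F]_m}).

Definition remove S w v := (w v - (v \in S))%N.

Definition supported S w := forall v, v != 0 -> v \in S -> (0 < w v)%N.

Definition packs k w ss := (forall S, S \in ss -> \dim S = k.+1) /\
  forall v, v != 0 -> (count (fun S => v \in S) ss <= w v)%N.

Lemma mass_remove S w U : supported S w ->
  (mass (remove S w) U + (p ^ \dim (U :&: S) - 1) = mass w U)%N.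
Proof.
move=> sS; rewrite -mass_indicator -massD; apply: eq_mass => v v0 _.
by rewrite subnK //; case: (boolP (v \in S)) => // /(sS v v0).
Qed.

Lemma memvZ_eq U a (v : 'rV[F]_m) : a != 0 -> (a *: v \in U) = (v \in U).
Proof.
by move=> a0; apply/idP/idP => [|/memvZ //]; rewrite -{2}[v](scalerK a0); apply: memvZ.
Qed.

Lemma remove_scale_inv S w : scale_inv w -> scale_inv (remove S w).
Proof. by move=> wi a v a0; rewrite /remove wi // memvZ_eq. Qed.

Lemma packs_remove k S w ss : supported S w -> \dim S = k.+1 -> packs k (remove S w) ss ->
  packs k w (S :: ss).
Proof.
move=> sS dS [dss css]; split=> [S'|v v0 /=].
  by rewrite inE => /predU1P[->|/dss].
apply: leq_trans (leq_add (leqnn _) (css v v0)) _.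
by rewrite subnKC //; case: (boolP (v \in S)) => // /(sS v v0).
Qed.

Lemma packs_leq k w w' ss : (forall v, v != 0 -> (w v <= w' v)%N) -> packs k w ss -> packs k w' ss.
Proof. by move=> ww [d c]; split=> // v v0; apply: leq_trans (ww v v0); apply: c. Qed.

Lemma mass_packs k w ss U : packs k w ss ->
  (\sum_(S <- ss) (p ^ \dim (U :&: S) - 1) <= mass w U)%N.
Proof.
case=> _ css; rewrite (eq_bigr (fun S => mass (fun v => (v \in S) : nat) U)).
  rewrite -mass_sum; apply: leq_mass => v v0 _; apply: leq_trans (css v v0).
  by rewrite -sum1_count [X in (_ <= X)%N]big_mkcond leq_sum // => S _; case: ifP.
by move=> S _; rewrite mass_indicator.
Qed.

Lemma line_supported v w : scale_inv w -> (0 < w v)%N -> supported <[v]>%VS w.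
Proof.
move=> wi wv u u0 /vlineP[a E]; rewrite E wi //.
by apply: contraNneq u0 => a0; rewrite E a0 scale0r.
Qed.

Lemma exists_minimal k t w : scale_inv w -> blocks k t w ->
  exists w', [/\ scale_inv w', blocks k t w', minimal k t w' & forall v, (w' v <= w v)%N].
Proof.
move: {2}(mass w fullv) (leqnn (mass w fullv)) => h.
elim: h w => [|h IH] w hw wi wB.
  exists w; split=> // v v0 wv; move: hw; rewrite leqn0 sum_nat_eq0 => /forallP/(_ v).
  by rewrite v0 memvf /= => /eqP w0; rewrite w0 in wv.
have [/existsP[v /and3P[v0 wv /forallP H]]|/existsPn H] :=
  boolP [exists v, [&& v != 0, (0 < w v)%N & [forall U : {vspace 'rV[F]_m},
    (v \in U) && (\dim U + k == m)%N ==> (mass w U != t * p.-1)%N]]]; last first.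
  exists w; split=> // v v0 wv; have := H v; rewrite v0 wv /= negb_forall => /existsP[U].
  rewrite negb_imply negbK => /andP[/andP[vU /eqP dU] /eqP mU]; by exists U.
have sv := line_supported wi wv.
have [|||w' [w'i w'B w'M w'w]] := IH (remove <[v]>%VS w).
- rewrite -ltnS; apply: leq_trans hw; rewrite -(mass_remove fullv sv) -addn1 leq_add2l.
  by rewrite capfv dim_vline v0 expn1 subn_gt0 card_gt1.
- exact: remove_scale_inv.
- move=> U dU; have := mass_remove U sv; have := wB U dU.
  have [vU|vU] := boolP (v \in U).
    have := H U; rewrite vU dU eqxx /= => ne le.
    have -> : (U :&: <[v]>)%VS = <[v]>%VS by apply/capv_idPr; rewrite -memvE.
    rewrite dim_vline v0 expn1 subn1 => E.
    (* Masses are multiples of p - 1, so a subspace that is not tight has room for the loss of one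
       whole point. *)
    have : (t * p.-1 < mass w U)%N by rewrite ltn_neqAle eq_sym ne.
    have [y Ey] := dvdnP (mass_dvd U wi); rewrite Ey ltn_pmul2r ?p1_gt0 // => ty.
    have [y' Ey'] := dvdnP (mass_dvd U (remove_scale_inv <[v]>%VS wi)).
    rewrite Ey' leq_pmul2r ?p1_gt0 // -ltnS; apply: leq_trans ty _.
    by rewrite -(leq_pmul2r (p1_gt0 F)) -Ey -E Ey' mulSn addnC.
  have -> : (U :&: <[v]>)%VS = 0%VS.
    apply/eqP; rewrite -subv0; apply/subvP => u; rewrite memv_cap => /andP[uU /vlineP[a E]].
    rewrite memv0 E; have [->|a0] := eqVneq a 0; first by rewrite scale0r.
    by case/negP: vU; rewrite -(memvZ_eq U v a0) -E.
  by rewrite dimv0 expn0 subnn addn0 => le ->.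
exists w'; split=> // u; apply: leq_trans (w'w u) _; exact: leq_subr.
Qed.

End Remove.

(** Containment in an arbitrary small blocking weight is the form that passes through the induction:
    removing a subspace, projecting and restricting need not preserve minimality. *)
Definition decomposes k m := forall t (w : 'rV[F]_m -> nat), (t < p)%N -> scale_inv w ->
  blocks k t w -> small k t w -> exists2 ss, size ss = t & packs k w ss.

Lemma decomposes0 m : decomposes 0 m.
Proof.
move=> t w _ wi wB _; have {wB} : (t * p.-1 <= mass w fullv)%N.
  by apply: wB; rewrite addn0 dim_rV.
elim: t w wi => [|t IH] w wi wB; first by exists [::].
have [|v [v0 _ wv]] := @mass_gt_pos F m w fullv.
  by apply: leq_trans wB; rewrite muln_gt0 p1_gt0.
have sv := line_supported wi wv.
have [||ss sss pss] := IH (remove <[v]>%VS w); first exact: remove_scale_inv.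
  have := mass_remove fullv sv; rewrite capfv dim_vline v0 expn1 subn1 => E.
  by rewrite -(leq_add2r p.-1) E addnC -mulSn.
exists (<[v]>%VS :: ss); first by rewrite /= sss.
by apply: packs_remove => //; rewrite dim_vline v0.
Qed.

End Packings.

Lemma link_small_arith (p q t w s M N : nat) : (1 < p)%N -> (0 < q)%N -> (w <= t)%N ->
  (2 * N <= p.-1 * ((2 * t + 1) * (p * q) - 1))%N -> (M + p.-1 * w = N)%N ->
  (p * (p.-1 * s) + t * (p * (p * q) - 1) = M + w * (p * (p * q) - 1))%N ->
  (2 * (p.-1 * s) <= p.-1 * ((2 * w + 1) * q - 1))%N.
Proof.
case: p => [|[|a]] //= _; case: q => // q _ /subnKC <-; move: (t - w)%N => D.
have -> : (a.+2 * (a.+2 * q.+1) - 1 = a.+2 * (a.+2 * q + a.+1) + a.+1)%N by lia.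
have -> : ((2 * (w + D) + 1) * (a.+2 * q.+1) - 1 =
  (2 * (w + D) + 1) * (a.+2 * q + a.+1) + 2 * (w + D))%N by lia.
move=> H1 H2 H3; rewrite mulnCA leq_pmul2l //.
rewrite leqNgt; apply/negP => H4.
have {}H4 : ((2 * w + 1) * q.+1 <= 2 * s)%N by lia.
have {}H4 : (a.+2 * (a.+1 * ((2 * w + 1) * q.+1)) <= a.+2 * (a.+1 * (2 * s)))%N.
  by rewrite !leq_mul2l H4 !orbT.
lia.
Qed.

Lemma supported_arith (p q t w N S e : nat) : (1 < p)%N -> (0 < q)%N -> (0 < w)%N -> (w <= t)%N ->
  (2 * N + 2 * t * (p * q - 1) <= 2 * t * (p * (p * q) - 1) + (p - 1) * (p * q - 1))%N ->
  (p * q - 1 + (w - 1) * (q - 1) <= e)%N ->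
  (p * e + t * (p * q - 1) + p.-1 * w = S + w * (p * q - 1))%N ->
  (S + t * (p * (p * q) - p * q) <= N)%N -> False.
Proof.
case: p => [|[|a]] // _; case: q => // q _; case: w => // w _ /subnKC <-.
move: (t - w.+1)%N => D /=.
have -> : (a.+2 * q.+1 - 1 = a.+2 * q + a.+1)%N by lia.
have -> : (a.+2 * (a.+2 * q.+1) - 1 = a.+2 * (a.+2 * q + a.+1) + a.+1)%N by lia.
have -> : (a.+2 * (a.+2 * q.+1) - a.+2 * q.+1 = a.+1 * (a.+2 * q.+1))%N by lia.
rewrite !subn1 /= => H1 H2 H3 H4.
have {H2} H5 : (a.+2 * (a.+2 * q + a.+1 + w * q) <= a.+2 * e)%N by rewrite leq_mul2l H2 orbT.
lia.
Qed.

Section Step.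

Variable F : finFieldType.
Local Notation p := #|F|.

Lemma quotient_image m d (Q : 'rV[F]_m) (g : 'Hom('rV[F]_m, 'rV[F]_d)) (S : {vspace 'rV[F]_m}) :
  Q != 0 -> lker g = <[Q]>%VS -> Q \in S ->
  (g @^-1: (g @: S))%VS = S /\ (\dim (g @: S)).+1 = \dim S.
Proof.
move=> Q0 kg QS; have kS : (lker g <= S)%VS by rewrite kg -memvE.
split; last first.
  by rewrite -(limg_ker_dim g S) (capv_idPr kS) kg dim_vline Q0.
apply/vspaceP => v; rewrite -memv_preim; apply/idP/idP => [|/memv_img -> //].
case/memv_imgP=> u uS E; rewrite -(subrK u v) memvD //.
by apply: (subvP kS); rewrite memv_ker linearB /= E subrr.
Qed.

Section Dimension.

Variables (j t : nat) (w : 'rV[F]_j.+3 -> nat).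
Local Notation k := j.+1.
Local Notation V := 'rV[F]_k.+2.
Hypotheses (tp : (t < p)%N) (t_gt0 : (0 < t)%N) (wi : scale_inv w).
Hypotheses (wB : blocks k t w) (wS : small k t w) (wM : minimal k t w).
Hypothesis lines : forall U : {vspace V}, \dim U = 2%N -> (p %| pts w U - t)%N.
Hypothesis decomp_link : decomposes F j j.+2.

Let k_gt0 : (0 < k)%N. Proof. by []. Qed.

(** A plane with a zero-weight point Q is covered by its lines through Q, each with at least t
    points. Otherwise all its points have positive weight, and t < p suffices. *)
Lemma plane_lower (E : {vspace V}) : \dim E = 3%N -> (t * (p ^ 2 - 1) <= mass w E)%N.
Proof.
move=> dE; have [H|] := ltnP (mass w E) (p ^ \dim E - 1).
  have [Q [Q0 QE wQ]] := mass_lt_zero H; have [g kg] := exists_quotient_point Q0.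
  have [gE dg] := quotient_image Q0 kg QE.
  rewrite -gE -(mass_quotient wi Q0 kg) wQ muln0 addn0.
  have -> : (p ^ 2 - 1 = p ^ \dim (g @: E) - 1)%N by move: dg; rewrite dE => -[->].
  rewrite -mass_const; apply: leq_mass => u u0 _.
  by have := push_lower wi wB Q0 kg u0; rewrite wQ addn0.
rewrite dE; apply: leq_trans; have := tp; have := card_gt1 F.
by rewrite !expnS expn0; move: p => P; nia.
Qed.

Lemma weight_le v : v != 0 -> (w v <= t)%N.
Proof.
move=> v0; case: (posnP (w v)) => [->//|wv].
have [U [vU _ mU]] := wM v0 wv.
rewrite -(leq_pmul2r (p1_gt0 F)) -mU mulnC -mass_line //.
by apply: massS; rewrite -memvE.
Qed.

Theorem exists_hyperplane : exists S : {vspace V}, [/\ \dim S = k.+1, supported S w &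
  forall U : {vspace V}, (U <= S)%VS -> \dim U = 2%N -> (t + p <= pts w U)%N].
Proof.
have P1 := card_gt1 F.
have q0 : (0 < p ^ j)%N by rewrite expn_gt0 (ltnW P1).
have [P [P0 _ wP]] : exists v, [/\ v != 0, v \in (fullv : {vspace V}) & (0 < w v)%N].
  apply: mass_gt_pos; apply: leq_trans (zero_lower tp wi wB wS).
  rewrite muln_gt0 t_gt0 subn_gt0 (leq_trans P1) // -{1}[p]expn1 leq_exp2l //.
have wPt := weight_le P0.
have [g kg] := exists_quotient_point P0.
(* [push] leaves out P itself, whose weight is added back on every line; [lines] makes the division
   exact. *)
pose e u := ((push g w u + w P - t) %/ p)%N.
have eE u : u != 0 -> (p * e u + t = push g w u + w P)%N.
  move=> u0; have := lines (quotient_line P0 kg u0).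
  rewrite (pts_quotient_line wi P0 kg) // => d; rewrite mulnC divnK // subnK //.
  exact: (push_lower wi wB P0 kg).
have ei : scale_inv e by move=> a u a0; rewrite /e push_scale_inv.
have meE E : (p * mass e E + t * (p ^ \dim E - 1) =
    mass (push g w) E + w P * (p ^ \dim E - 1))%N.
  rewrite -mass_eq_scale -!mass_const -!massD; apply: eq_mass => u u0 _; exact: eE.
(* Lines of the quotient are planes through P. Adding [eE] over the p + 1 lines of such a plane
   counts P exactly p extra times, and [plane_lower] leaves p e >= p w(P). *)
have eB : blocks j (w P) e.
  move=> E dEj; have dE : \dim E = 2%N by apply: (@addIn j); rewrite dEj.
  have := meE E; rewrite dE => E1; have := mass_quotient wi P0 kg E => E2.
  have d3 : \dim (g @^-1: E) = 3%N.
    by rewrite dim_preim ?(quotient_full (dim_line P0)) // kg dim_vline P0 dE.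
  have := plane_lower d3; rewrite -E2; move: E1.
  move: (mass e E) (mass _ E) => a b; rewrite expnS expn1.
  case: p P1 => [|[|c]] //= _ E1 H; rewrite -(leq_pmul2l (ltn0Sn c.+1)); nia.
have eS : small j (w P) e.
  rewrite /small; have [s ms] := dvdnP (mass_dvd fullv ei); rewrite ms [(s * _)%N]mulnC.
  apply: (@link_small_arith p (p ^ j) t (w P) s (mass (push g w) fullv) (mass w fullv)) => //.
  - by rewrite -expnS.
  - exact: (mass_quotient_full wi P0 kg).
  - by have := meE fullv; rewrite ms dim_rV -!expnS [(s * _)%N]mulnC.
have [[|S' ss] sss pss] := decomp_link (leq_ltn_trans wPt tp) ei eB eS.
  by rewrite -sss in wP.
have dS' : \dim S' = k by apply: pss.1; rewrite mem_head.
pose S := (g @^-1: S')%VS.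
have dS : \dim S = k.+1.
  by rewrite dim_preim ?(quotient_full (dim_line P0)) // kg dim_vline P0 dS' addn1.
(* S' counts in full, and each of the other w(P) - 1 members meets it in dimension at least j, all
   having dimension j + 1 in a space of dimension j + 2. *)
have eS' : (p ^ k - 1 + (w P - 1) * (p ^ j - 1) <= mass e S')%N.
  apply: leq_trans (mass_packs S' pss); rewrite big_cons capvv dS' leq_add2l.
  have -> : (w P - 1 = size ss)%N by rewrite -sss subn1.
  rewrite -sum1_size big_distrl /= big_seq [X in (_ <= X)%N]big_seq leq_sum // => S2 S2s.
  rewrite mul1n leq_sub2r // leq_exp2l //.
  have dS2 : \dim S2 = k by apply: pss.1; rewrite inE S2s orbT.
  have := dimv_sum_cap S' S2; rewrite dS' dS2; have := dimvS (subvf (S' + S2)).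
  rewrite dim_rV; move: (\dim _) (\dim _) => a b; lia.
(* Were Q in S of weight zero, each line through Q outside S would still need t points; added to the
   mass of S forced by [eS'], this exceeds [mass_excess]. *)
have supp : supported S w.
  move=> Q Q0 QS; rewrite lt0n; apply/negP => /eqP wQ.
  have [h kh] := exists_quotient_point Q0; have [Sh dh] := quotient_image Q0 kh QS.
  have lc u : u != 0 -> (t <= push h w u)%N.
    by move=> u0; have := push_lower wi wB Q0 kh u0; rewrite wQ addn0.
  have := mass_full_lower (h @: S)%VS lc.
  have -> : \dim (h @: S) = k by move: dh; rewrite dS => -[].
  have -> : mass (push h w) (h @: S) = mass w S.
    by rewrite -[in RHS]Sh -(mass_quotient wi Q0 kh) wQ muln0 addn0.
  have -> : mass (push h w) fullv = mass w fullv.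
    by rewrite -(mass_quotient_full wi Q0 kh) wQ muln0 addn0.
  rewrite !(expnS _ k) (expnS _ j) => H.
  apply: (@supported_arith p (p ^ j) t (w P) (mass w fullv) (mass w S) (mass e S')) => //.
  - by have := mass_excess wS; rewrite !expnS.
  - by rewrite -expnS.
  - rewrite -expnS /S -(mass_quotient wi P0 kg).
    by have := meE S'; rewrite dS' => ->; rewrite addnAC.
exists S; split=> // U US dU.
(* A count above t and congruent to t modulo p is at least t + p. *)
have : (p.+1 <= pts w U)%N.
  rewrite -(leq_pmul2l (p1_gt0 F)) -pts_mass //.
  apply: (@leq_trans (1 * (p ^ \dim U - 1))%N).
    by rewrite dU mul1n; case: p P1 => [|c] //= _; nia.
  by rewrite -mass_const; apply: leq_mass => v v0 vU; apply: supp => //; apply: (subvP US).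
have := lines dU => /dvdnP[x]; move: tp; move: (pts w U) => y.
case: x => [|x]; first by rewrite mul0n; lia.
by rewrite mulSn; move: (x * p)%N => z; lia.
Qed.

End Dimension.

Hypothesis lines : forall k t (w : 'rV[F]_k.+2 -> nat), (0 < k)%N -> (0 < t < p)%N ->
  scale_inv w -> blocks k t w -> small k t w -> minimal k t w ->
  forall U : {vspace 'rV[F]_k.+2}, \dim U = 2%N -> (p %| pts w U - t)%N.

Lemma small_leq m k t (w w' : 'rV[F]_m -> nat) : (forall v, (w' v <= w v)%N) ->
  small k t w -> small k t w'.
Proof.
by move=> ww; apply: leq_trans; rewrite leq_mul2l leq_mass.
Qed.

Theorem decomposes_plus2 k : decomposes F k k.+2.
Proof.
elim: k => [|j IHj]; first exact: decomposes0.
elim=> [|t IHt] w tp wi wB wS; first by exists [::].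
have [w' [w'i w'B w'M ww]] := exists_minimal wi wB.
have w'S := small_leq ww wS.
have [//|S [dS sS hS]] := exists_hyperplane tp (ltn0Sn t) w'i w'B w'S w'M _ IHj.
  by apply: lines.
have ri := remove_scale_inv S w'i.
have P1 := card_gt1 F.
have [||ss sss pss] := IHt (remove S w') (ltnW tp) ri.
- move=> U dU; have dU2 : \dim U = 2%N by apply: (@addIn j.+1); rewrite dU.
  (* Lines inside S lose p + 1 points but had at least t + 1 + p; all other lines lose at most
     one. *)
  have := mass_remove U sS; have [US|US] := boolP (U <= S)%VS.
    rewrite (capv_idPl US) dU2 => E.
    have : (p.-1 * (t.+1 + p) <= mass w' U)%N by rewrite pts_mass // leq_mul2l hS ?orbT.
    rewrite -E; move: (mass _ _) => x.
    by case: p P1 => [|[|a]] //= _; rewrite !expnS expn0; lia.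
  have : (\dim (U :&: S) <= 1)%N.
    rewrite -ltnS -dU2 ltnNge; apply: contra US => le; apply/capv_idPl/eqP.
    by rewrite eqEdim capvSl.
  move=> d1 E; have : (p ^ \dim (U :&: S) - 1 <= p.-1)%N.
    by rewrite -subn1 leq_sub2r // -{2}[p]expn1 leq_exp2l.
  have := w'B U dU; rewrite -E mulSn; move: (mass _ _) (p ^ _)%N => a b; lia.
- have := mass_remove fullv sS; rewrite capfv dS => E.
  have := w'S; rewrite /small -E !expnS; move: (mass _ _) => a.
  have : (0 < p ^ j)%N by rewrite expn_gt0 (ltnW P1).
  by move: (p ^ j)%N => q; case: p P1 => [|[|b]] //= _ q0; nia.
exists (S :: ss); first by rewrite /= sss.
by apply: (packs_leq (w := w')) => // ; apply: packs_remove.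
Qed.

End Step.

(** The rounding argument: if M were at least c + 1, the excess of N over t k-subspaces would be at
    least p q - 1 - (t - c)(q - 1), while less than half of p q - 1, minus t (q - 1), is
    available. *)
Lemma excess_lt (p q t N c M : nat) : (1 < p)%N -> (0 < q)%N ->
  (2 * N + 2 * t * (q - 1) <= 2 * t * (p * q - 1) + (p - 1) * (q - 1))%N ->
  (c <= t)%N -> (M * (p * q - 1) + t * (p * q - 1) <=
    c * (p * q - 1) + (t - c) * (q - 1) + N)%N -> (M <= c)%N.
Proof.
move=> p1 q0 H1 ct H2; rewrite leqNgt; apply/negP => cM.
have H3 : (c.+1 * (p * q - 1) <= M * (p * q - 1))%N by rewrite leq_mul2r cM orbT.
rewrite mulSn in H3.
have H4 : ((t - c) * (q - 1) <= t * (q - 1))%N by rewrite leq_mul2r leq_subr orbT.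
have H5 : ((p - 1) * (q - 1) < 2 * (p * q - 1))%N.
  by case: p p1 {H1 H2 H3} => [|[|a]] //= _; case: q q0 {H4} => // q _; nia.
move: H1 H2 H3 H4 H5; rewrite -!(mulnA 2).
move: (c * (_ - _))%N (M * _)%N (t * (p * q - 1))%N (t * (q - 1))%N ((t - c) * _)%N.
by move: ((p - 1) * _)%N (p * q - 1)%N => a b c0 d e f g; lia.
Qed.

Lemma fold_arith (p q t s n K N : nat) : (1 < p)%N -> (0 < q)%N ->
  (2 * N + 2 * t * (q - 1) <= 2 * t * (p * q - 1) + (p - 1) * (q - 1))%N ->
  (s <= t)%N -> (s * (p * q - 1) + (t - s) * (q - 1) <= K)%N ->
  (K + (t - n) * (p * q - q) <= N)%N -> (s <= n)%N.
Proof.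
move=> p1 q0 H1 st H2 H3; rewrite leqNgt; apply/negP => ns.
move: (st) ns H1 H2 H3 => /subnKC <-; move: (t - s)%N => r /subnKC <-.
move: (s - n.+1)%N => s'; case: p p1 => [|[|a]] // _; case: q q0 => // q _.
have -> : (a.+2 * q.+1 - q.+1 = a.+1 * q.+1)%N by lia.
have -> : (a.+2 * q.+1 - 1 = a.+2 * q + a.+1)%N by lia.
have -> : (n.+1 + s' + r - n = s' + r + 1)%N by lia.
have -> : (n.+1 + s' + r - (n.+1 + s') = r)%N by lia.
rewrite !subn1 /=; lia.
Qed.

Lemma fold_small_arith (p q t s K N : nat) : (1 < p)%N -> (0 < q)%N ->
  (2 * N + 2 * t * (q - 1) <= 2 * t * (p * q - 1) + (p - 1) * (q - 1))%N ->
  (s <= t)%N -> (K + t * (p * q - 1) <= s * (p * q - 1) + (t - s) * (q - 1) + N)%N ->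
  (2 * K <= p.-1 * ((2 * s + 1) * q - 1))%N.
Proof.
move=> p1 q0 H1 /subnKC ts; move: H1; rewrite -ts; move: (t - s)%N => r.
rewrite [(s + r - s)%N]addKn.
case: p p1 => [|[|a]] // _; case: q q0 => // q _ /=.
have -> : (a.+2 * q.+1 - 1 = a.+2 * q + a.+1)%N by lia.
have -> : ((2 * s + 1) * q.+1 - 1 = (2 * s + 1) * q + 2 * s)%N by lia.
rewrite !subn1 /=; lia.
Qed.

(** * Counting with packed subspaces *)

Section Packs.

Variables (F : finFieldType) (m k : nat).
Local Notation p := #|F|.
Implicit Types (w : 'rV[F]_m -> nat) (U S E : {vspace 'rV[F]_m}) (ss : seq {vspace 'rV[F]_m}).

(** The leftover weight, w minus the packed subspaces, is nonnegative, so there is no more of it in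
    U than in E. *)
Lemma packs_upper w ss U E : packs k w ss -> (U <= E)%VS -> (forall S, S \in ss -> (S <= E)%VS) ->
  (mass w U + size ss * (p ^ k.+1 - 1) <= \sum_(S <- ss) (p ^ \dim (U :&: S) - 1) + mass w E)%N.
Proof.
move=> [dss css] UE sE; pose c v := count (fun S => v \in S) ss.
have mc W : mass c W = (\sum_(S <- ss) (p ^ \dim (W :&: S) - 1))%N.
  rewrite (eq_bigr (fun S => mass (fun v => (v \in S) : nat) W)).
    rewrite -mass_sum; apply: eq_mass => v _ _.
    by rewrite /c -sum1_count [LHS]big_mkcond; apply: eq_bigr => S _; case: ifP.
  by move=> S _; rewrite mass_indicator.
have mw W : mass w W = (mass c W + mass (fun v => w v - c v)%N W)%N.
  by rewrite -massD; apply: eq_mass => v v0 _; rewrite subnKC // css.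
have <- : mass c E = (size ss * (p ^ k.+1 - 1))%N.
  rewrite mc big_seq (eq_bigr (fun=> (p ^ k.+1 - 1)%N)) => [|S Ss].
    by rewrite -big_seq big_const_seq iter_addn_0 count_predT mulnC.
  by rewrite (capv_idPr (sE S Ss)) dss.
by rewrite (mw U) (mw E) -mc -addnA leq_add2l addnC leq_add2l massS.
Qed.

Lemma sum_dim_bound ss (U : {vspace 'rV[F]_m}) (P : pred {vspace 'rV[F]_m}) :
  (forall S, S \in ss -> \dim S = k.+1) ->
  (forall S, S \in ss -> ~~ P S -> ~~ (S <= U)%VS) ->
  (\sum_(S <- ss) (p ^ \dim (U :&: S) - 1) <=
   count P ss * (p ^ k.+1 - 1) + (size ss - count P ss) * (p ^ k - 1))%N.
Proof.
move=> dss PU; rewrite -(count_predC P ss) addKn (bigID P) /=; apply: leq_add.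
  rewrite -sum1_count big_distrl /= big_seq_cond [X in (_ <= X)%N]big_seq_cond leq_sum // => S.
  case/andP=> Ss _; rewrite mul1n leq_sub2r // leq_exp2l ?card_gt1 //.
  by rewrite -(dss S Ss) dimvS // capvSr.
rewrite -sum1_count big_distrl /= big_seq_cond [X in (_ <= X)%N]big_seq_cond leq_sum // => S.
case/andP=> Ss nP; rewrite mul1n leq_sub2r // leq_exp2l ?card_gt1 //.
rewrite -ltnS -(dss S Ss) ltnNge; apply: contra (PU S Ss nP) => le.
by apply/capv_idPr/eqP; rewrite eqEdim capvSr.
Qed.

Lemma sum_dim_lower ss (U : {vspace 'rV[F]_m}) : (\dim U).+1 = m ->
  (forall S, S \in ss -> \dim S = k.+1) ->
  (count (fun S => (S <= U)%VS) ss * (p ^ k.+1 - 1) +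
    (size ss - count (fun S => (S <= U)%VS) ss) * (p ^ k - 1) <=
   \sum_(S <- ss) (p ^ \dim (U :&: S) - 1))%N.
Proof.
move=> dU dss; rewrite -(count_predC (fun S => (S <= U)%VS) ss) addKn.
rewrite (bigID (fun S => (S <= U)%VS)) /=; apply: leq_add.
  rewrite -sum1_count big_distrl /= big_seq_cond [X in (_ <= X)%N]big_seq_cond leq_sum // => S.
  by case/andP=> Ss /capv_idPr ->; rewrite mul1n dss.
rewrite -sum1_count big_distrl /= big_seq_cond [X in (_ <= X)%N]big_seq_cond leq_sum // => S.
case/andP=> Ss _; rewrite mul1n leq_sub2r // leq_exp2l ?card_gt1 //.
have := dimv_sum_cap U S; rewrite (dss S Ss); have := dimvS (subvf (U + S)).
rewrite dim_rV; move: (\dim (U + S)) (\dim (U :&: S)) dU => a b; move: (\dim U) => c; lia.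
Qed.

End Packs.

Section Restrict.

Variables (F : finFieldType) (m d : nat) (i : 'Hom('rV[F]_d, 'rV[F]_m)).
Hypothesis ker_i : lker i = 0%VS.

Lemma embedding_inj : injective i.
Proof. by apply/lker0P; rewrite ker_i. Qed.

Lemma mem_embedding a (S : {vspace 'rV[F]_d}) : (i a \in (i @: S)%VS) = (a \in S).
Proof.
apply/idP/idP => [/memv_imgP[b bS /embedding_inj ->] //|]; exact: memv_img.
Qed.

Lemma dim_embedding (S : {vspace 'rV[F]_d}) : \dim (i @: S) = \dim S.
Proof. by rewrite limg_dim_eq // ker_i capv0. Qed.

Lemma mass_embedding (w : 'rV[F]_m -> nat) (S : {vspace 'rV[F]_d}) :
  mass (fun a => w (i a)) S = mass w (i @: S).
Proof.
rewrite /mass [RHS](eq_bigl (fun v => v \in [set i a | a in [pred a | (a != 0) && (a \in S)]])).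
  rewrite big_imset /=; first by apply: eq_bigl => a; rewrite inE.
  by move=> a b _ _; apply: embedding_inj.
move=> v; apply/andP/imsetP => [[v0 /memv_imgP[a aS E]]|[a]].
  exists a => //; rewrite inE aS andbT; apply: contraNneq v0 => a0.
  by rewrite E a0 linear0.
rewrite inE => /andP[a0 aS] ->; rewrite mem_embedding aS; split=> //.
by rewrite -memv_ker ker_i memv0.
Qed.

End Restrict.

(** * Decomposition in higher dimension *)

Section Lift.

Variables (F : finFieldType) (m k t : nat).
Local Notation p := #|F|.
Local Notation V := 'rV[F]_m.+1.
Variable w : V -> nat.
Hypotheses (k_gt0 : (0 < k)%N) (km : (k.+2 <= m)%N) (tp : (t < p)%N).
Hypotheses (wi : scale_inv w) (wB : blocks k t w) (wS : small k t w).
Hypothesis IH : decomposes F k m.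

Let p_gt1 : (1 < p)%N := card_gt1 F.
Let q_gt0 : (0 < p ^ k)%N.
Proof. by rewrite expn_gt0 (ltnW p_gt1). Qed.

Let excess : (2 * mass w fullv + 2 * t * (p ^ k - 1) <=
  2 * t * (p * p ^ k - 1) + (p - 1) * (p ^ k - 1))%N.
Proof. exact: excess_arith. Qed.

Let dim_point (Q : V) : Q != 0 -> (\dim <[Q]> + m = m.+1)%N.
Proof. by move=> Q0; rewrite dim_vline Q0. Qed.

Lemma exists_zero_in (K : {vspace V}) : (k.+2 <= \dim K)%N ->
  exists Q, [/\ Q != 0, Q \in K & w Q = 0%N].
Proof.
move=> dK; apply: mass_lt_zero; apply: leq_ltn_trans (massS w (subvf K)) _.
apply: leq_trans (zero_arith p_gt1 q_gt0 tp wS) _.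
by rewrite leq_sub2r // -!expnS leq_exp2l.
Qed.

Section Projection.

Variables (Q : V) (g : 'Hom(V, 'rV[F]_m)).
Hypotheses (Q_neq0 : Q != 0) (kerg : lker g = <[Q]>%VS) (wQ : w Q = 0%N).

Lemma mass_projection (E : {vspace 'rV[F]_m}) : mass (push g w) E = mass w (g @^-1: E).
Proof. by rewrite -mass_push kerg mass_line // wQ muln0 addn0. Qed.

Lemma mass_projection_full : mass (push g w) fullv = mass w fullv.
Proof.
rewrite mass_projection; congr (mass w _); apply/vspaceP => v.
by rewrite memvf -memv_preim memvf.
Qed.

Lemma mass_projection_image (K : {vspace V}) : Q \in K -> mass (push g w) (g @: K) = mass w K.
Proof. by move=> QK; rewrite mass_projection (quotient_image Q_neq0 kerg QK).1. Qed.

Lemma exists_projection_packs : exists2 ss, size ss = t & packs k (push g w) ss.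
Proof.
apply: IH tp _ _ _; first exact: push_scale_inv.
- move=> E dE; rewrite mass_projection; apply: wB.
  rewrite dim_preim ?(quotient_full (dim_point Q_neq0)) // kerg dim_vline Q_neq0.
  by rewrite addn1 addSn dE.
- by rewrite /small mass_projection_full.
Qed.

Variable ss : seq {vspace 'rV[F]_m}.
Hypotheses (ss_size : size ss = t) (ss_packs : packs k (push g w) ss).

Lemma image_sub (S K : {vspace V}) : Q \in K -> (g @: S <= g @: K)%VS = (S <= K)%VS.
Proof.
move=> QK; apply/idP/idP => [SK|]; last exact: limgS.
rewrite -(quotient_image Q_neq0 kerg QK).1; apply/subvP => v vS.
by rewrite -memv_preim (subvP SK) // memv_img.
Qed.

Lemma restriction_upper (E : {vspace 'rV[F]_m}) (P : pred {vspace 'rV[F]_m}) :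
  (forall S, S \in ss -> ~~ P S -> ~~ (S <= E)%VS) ->
  (mass (push g w) E + t * (p ^ k.+1 - 1) <=
   count P ss * (p ^ k.+1 - 1) + (t - count P ss) * (p ^ k - 1) + mass w fullv)%N.
Proof.
move=> PE; have := packs_upper ss_packs (subvf E) (fun S _ => subvf S).
rewrite ss_size mass_projection_full => H; apply: leq_trans H _.
by rewrite leq_add2r -ss_size; apply: sum_dim_bound PE; apply: ss_packs.1.
Qed.

Section Hyperplane.

Variable K : {vspace V}.
Hypotheses (dK : \dim K = m) (QK : Q \in K).
Local Notation s := (count (fun S' => (S' <= g @: K)%VS) ss).

Let st : (s <= t)%N. Proof. by rewrite -ss_size count_size. Qed.

Lemma hyperplane_lower : (s * (p ^ k.+1 - 1) + (t - s) * (p ^ k - 1) <= mass w K)%N.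
Proof.
rewrite -mass_projection_image // -ss_size.
apply: leq_trans (mass_packs _ ss_packs); apply: sum_dim_lower; last exact: ss_packs.1.
by rewrite (quotient_image Q_neq0 kerg QK).2 dK.
Qed.

Lemma hyperplane_upper : (mass w K + t * (p ^ k.+1 - 1) <=
  s * (p ^ k.+1 - 1) + (t - s) * (p ^ k - 1) + mass w fullv)%N.
Proof. by rewrite -mass_projection_image //; apply: restriction_upper. Qed.

(** If W had n < s points, each subspace one dimension larger that contains W but is not inside K
    would add at least t - n points. With [hyperplane_lower] for K itself, the total would be too
    large. *)
Lemma hyperplane_blocks (W : {vspace V}) : (W <= K)%VS -> (\dim W + k = m)%N ->
  (s * p.-1 <= mass w W)%N.
Proof.
move=> WK dW; have dWm : (\dim W + k.+1 = m.+1)%N by rewrite addnS dW.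
have [h kh] := exists_quotient dWm.
have [n mn] := dvdnP (mass_dvd W wi); rewrite mn leq_mul2r; apply/orP; right.
have lc u : u != 0 -> (t - n <= push h w u)%N.
  move=> u0; rewrite leq_subLR addnC -(leq_pmul2r (p1_gt0 F)) mulnDl -mn.
  rewrite [(push _ _ _ * _)%N]mulnC -(mass_quotient_line wi kh u0); apply: wB.
  by rewrite (dim_quotient_line dWm kh u0) addSn dW.
have := mass_full_lower (h @: K)%VS lc.
have hK : (h @^-1: (h @: K))%VS = K.
  apply/vspaceP => v; rewrite -memv_preim; apply/idP/idP => [|/memv_img -> //].
  case/memv_imgP=> u uK E; rewrite -(subrK u v) memvD //.
  by apply: (subvP WK); rewrite -kh memv_ker linearB /= E subrr.
have dhK : \dim (h @: K) = k.
  have := limg_ker_dim h K; rewrite kh (capv_idPr WK) dK => E.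
  by apply: (@addnI (\dim W)); rewrite E dW.
rewrite dhK => H.
apply: (@fold_arith p (p ^ k) t s n (mass w K) (mass w fullv)) => //.
  by rewrite -expnS; exact: hyperplane_lower.
rewrite -!expnS -hK -(mass_push h w) kh addnAC.
have <- : (mass (push h w) fullv + mass w W = mass w fullv)%N.
  rewrite -kh mass_push; congr (mass w _); apply/vspaceP => v.
  by rewrite memvf -memv_preim memvf.
by rewrite leq_add2r.
Qed.

Lemma exists_hyperplane_packs : exists ssK : seq {vspace V},
  [/\ size ssK = s, packs k w ssK & forall S, S \in ssK -> (S <= K)%VS].
Proof.
have [i [ki iK]] := exists_embedding dK.
have [|a v a0|E dE||ssK sK pK] := IH (t := s) (w := fun a => w (i a)).
- exact: leq_ltn_trans tp.
- by rewrite linearZ wi.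
- rewrite mass_embedding //; apply: hyperplane_blocks; first by rewrite -iK limgS ?subvf.
  by rewrite dim_embedding.
- rewrite /small mass_embedding // iK.
  apply: (@fold_small_arith p (p ^ k) t s (mass w K) (mass w fullv)) => //.
  by rewrite -expnS; apply: hyperplane_upper.
exists [seq (i @: W)%VS | W <- ssK]; split; first by rewrite size_map.
  split=> [S /mapP[S' S's ->]|v v0]; first by rewrite dim_embedding // pK.1.
  have [|vK] := boolP (v \in K).
    rewrite -iK => /memv_imgP[a _ va]; have cE : count (fun W : {vspace V} => v \in W)
        [seq (i @: W)%VS | W <- ssK] = count (fun W : {vspace 'rV[F]_m} => a \in W) ssK.
      by rewrite count_map; apply: eq_count => W /=; rewrite va mem_embedding.
    by rewrite cE va; apply: pK.2; apply: contraNneq v0 => a0; rewrite va a0 linear0.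
  rewrite (_ : count _ _ = 0%N) //; apply/eqP; rewrite -leqn0 leqNgt -has_count.
  apply/negP => /hasP[S /mapP[S' _ ->] vS]; case/negP: vK; rewrite -iK.
  exact: (subvP (limgS i (subvf S'))).
by move=> S /mapP[S' _ ->]; rewrite -iK limgS ?subvf.
Qed.

End Hyperplane.

End Projection.

(* The minimum of [w] on the nonzero vectors of [S], capped at [t]. *)
Definition mult (S : {vspace V}) : nat :=
  \max_(c < t.+1 | [forall v, (v != 0) && (v \in S) ==> (c <= w v)%N]) c.

Implicit Types (S K : {vspace V}) (v : V).

Lemma mult_le S v : v != 0 -> v \in S -> (mult S <= w v)%N.
Proof.
by move=> v0 vS; apply/bigmax_leqP => c /forallP/(_ v); rewrite v0 vS.
Qed.

Lemma mult_ge S c : (c <= t)%N -> (forall v, v != 0 -> v \in S -> (c <= w v)%N) ->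
  (c <= mult S)%N.
Proof.
move=> ct cw; have ct' : (c < t.+1)%N by [].
rewrite /mult; apply: (@bigop.bigmax_sup _ (Ordinal ct')) => //.
by apply/forallP => v; apply/implyP => /andP[v0 vS]; apply: cw.
Qed.

(** The leftover weight in S is bounded by that in K and so by the total excess, too little for one
    more copy of S. Hence the multiplicity of S does not depend on K or Q. *)
Lemma count_mult (Q : V) (g : 'Hom(V, 'rV[F]_m)) ss K (ssK : seq {vspace V}) S :
  Q != 0 -> lker g = <[Q]>%VS -> w Q = 0%N -> size ss = t -> packs k (push g w) ss ->
  \dim K = m -> Q \in K -> size ssK = count (fun E => (E <= g @: K)%VS) ss ->
  packs k w ssK -> (forall S, S \in ssK -> (S <= K)%VS) ->
  \dim S = k.+1 -> (S <= K)%VS -> count_mem S ssK = mult S.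
Proof.
move=> Q0 kg wQ sst pss dK QK sK pK ssKK dS SK; apply/eqP; rewrite eqn_leq; apply/andP; split.
  apply: mult_ge => [|v v0 vS].
    by apply: leq_trans (count_size _ _) _; rewrite sK -sst count_size.
  apply: leq_trans (pK.2 v v0); apply: sub_count => S' /= /eqP -> //.
set c := count_mem S ssK; set s := count _ ss in sK.
have ct : (c <= t)%N.
  by apply: leq_trans (count_size _ _) _; rewrite sK -sst count_size.
apply: (@excess_lt p (p ^ k) t (mass w fullv) c (mult S)) => //.
have H1 : (mult S * (p ^ k.+1 - 1) <= mass w S)%N.
  by rewrite -dS -mass_const; apply: leq_mass => v v0 vS; apply: mult_le.
have H2 := packs_upper pK SK ssKK.
have H3 := hyperplane_upper Q0 kg wQ sst pss QK.
have H4 : (\sum_(S2 <- ssK) (p ^ \dim (S :&: S2) - 1) <=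
    c * (p ^ k.+1 - 1) + (size ssK - c) * (p ^ k - 1))%N.
  apply: sum_dim_bound pK.1 _ => S2 S2s ne; apply: contra ne => S2S /=.
  by rewrite eqEdim S2S (pK.1 S2 S2s) dS leqnn.
have H5 : (t - c = (t - s) + (size ssK - c))%N.
  have : (c <= size ssK)%N by apply: count_size.
  have : (s <= t)%N by rewrite -sst count_size.
  rewrite sK -/s; lia.
rewrite -expnS H5 mulnDl; move: H1 H2 H3 H4; rewrite -/s -/(mass w K) sK.
move: (mass w S) (mass w K) (mass w fullv) (mult S * _)%N (t * _)%N (s * (p ^ k.+1 - 1))%N.
move: (c * _)%N ((t - s) * _)%N ((s - c) * _)%N (\sum_(_ <- _) _)%N.
by move=> a1 a2 a3 a4 a5 a6 a7 a8 a9 a10; lia.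
Qed.

Local Notation kspace := (fun S : {vspace V} => \dim S == k.+1).

Lemma sum_mult_hyperplane (P : pred {vspace V}) ssK K :
  packs k w ssK -> (forall S, S \in ssK -> (S <= K)%VS) ->
  (forall S, \dim S = k.+1 -> (S <= K)%VS -> count_mem S ssK = mult S) ->
  (forall S, P S -> (S <= K)%VS) ->
  (\sum_(S | kspace S && P S) mult S = count P ssK)%N.
Proof.
move=> pK sK cK PK; rewrite (eq_bigr (fun S => count_mem S ssK)); last first.
  by move=> S /andP[/eqP dS PS]; rewrite cK ?PK.
under eq_bigr => S _ do rewrite -sum1_count.
rewrite (exchange_big_dep xpredT) //= -sum1_count [RHS]big_mkcond /= big_seq [RHS]big_seq.
apply: eq_bigr => S Ss; have [PS|PS] := boolP (P S).
  rewrite (big_pred1 S) // => S' /=; rewrite [S == S']eq_sym; have [->|_] := eqVneq S' S.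
    by rewrite (pK.1 S Ss) eqxx PS.
  by rewrite andbF.
rewrite big_pred0 // => S' /=; have [<-|_] := eqVneq S S'; last by rewrite andbF.
by rewrite (negbTE PS) andbF.
Qed.

Lemma exists_projection (Q : V) : Q != 0 ->
  exists g : 'Hom(V, 'rV[F]_m), lker g = <[Q]>%VS.
Proof. by move=> Q0; apply: exists_quotient; apply: dim_point. Qed.

Section FixedCenter.

Variables (Q : V) (g : 'Hom(V, 'rV[F]_m)) (ss : seq {vspace 'rV[F]_m}).
Hypotheses (Q_neq0 : Q != 0) (kerg : lker g = <[Q]>%VS) (wQ : w Q = 0%N).
Hypotheses (ss_size : size ss = t) (ss_packs : packs k (push g w) ss).
Implicit Types (E : {vspace 'rV[F]_m}).

Lemma mult_center S : Q \in S -> mult S = 0%N.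
Proof. by move=> QS; apply/eqP; rewrite -leqn0 -wQ; apply: mult_le. Qed.

Definition projected_mult E := (\sum_(S | kspace S && ((g @: S)%VS == E)) mult S)%N.

(** All subspaces projecting into E lie in its preimage T, which fits into a hyperplane K as k + 2
    <= m. Each packed subspace inside T contributes its full mass to T, and the mass of T is that of
    E after projection; [excess_lt] compares the counts. *)
Lemma projected_mult_le E : \dim E = k.+1 -> (projected_mult E <= count_mem E ss)%N.
Proof.
move=> dE; pose T := (g @^-1: E)%VS.
have dT : \dim T = k.+2.
  by rewrite dim_preim ?(quotient_full (dim_point Q_neq0)) // kerg dim_vline Q_neq0 dE addn1.
have [|K TK dK] := @exists_supspace F m.+1 m T; first by rewrite dT km /=.
have QT : Q \in T.
  have : Q \in lker g by rewrite kerg memv_line.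
  by rewrite -memv_preim memv_ker => /eqP ->; rewrite mem0v.
have QK : Q \in K := subvP TK Q QT.
have [ssK [sK pK sKK]] := exists_hyperplane_packs Q_neq0 kerg wQ ss_size ss_packs dK QK.
have cK S dS SK := count_mult Q_neq0 kerg wQ ss_size ss_packs dK QK sK pK sKK (S := S) dS SK.
have subT S : (g @: S <= E)%VS -> (S <= T)%VS.
  by move=> SE; apply/subvP => v vS; rewrite -memv_preim (subvP SE) // memv_img.
have leT : (projected_mult E <= count (fun S => (S <= T)%VS) ssK)%N.
  rewrite -(sum_mult_hyperplane pK sKK cK) => [|S /subv_trans]; last exact.
  rewrite /projected_mult big_mkcond [X in (_ <= X)%N]big_mkcond leq_sum // => S _.
  by case: (\dim S == k.+1) => //=; case: eqP => // SE; rewrite subT ?SE.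
apply: leq_trans leT _.
apply: (@excess_lt p (p ^ k) t (mass w fullv)) => //.
  by rewrite -ss_size count_size.
have := restriction_upper Q_neq0 kerg wQ ss_size ss_packs (E := E) (P := pred1 E).
rewrite -!expnS => H; apply: leq_trans (H _).
  rewrite leq_add2r (mass_projection Q_neq0 kerg wQ) -/T; apply: leq_trans (mass_packs T pK).
  rewrite -sum1_count big_distrl /= big_seq_cond [X in (_ <= X)%N]big_seq big_mkcondr.
  rewrite leq_sum // => S Ss; case: ifP => // ST.
  by rewrite (capv_idPr ST) pK.1 // mul1n.
move=> S Ss; apply: contra => SE /=.
by rewrite eqEdim SE (ss_packs.1 S Ss) dE leqnn.
Qed.

Lemma sum_projected_mult (P : pred {vspace 'rV[F]_m}) :
  (\sum_(E | (\dim E == k.+1) && P E) projected_mult E =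
   \sum_(S | kspace S && P (g @: S)%VS) mult S)%N.
Proof.
rewrite /projected_mult (exchange_big_dep (fun S => kspace S && P (g @: S)%VS)) /=; last first.
  by move=> E S /andP[_ PE] /andP[-> /eqP ->].
apply: eq_bigr => S /andP[dS PS].
(* Subspaces through Q drop in dimension under g, but their [mult] is zero; the others keep their
   dimension. *)
have [QS|QS] := boolP (Q \in S).
  by rewrite mult_center // big1.
rewrite (big_pred1 (g @: S)%VS) // => E /=; rewrite dS [(g @: S)%VS == E]eq_sym /=.
have [->|_] := eqVneq E (g @: S)%VS; last by rewrite andbF.
rewrite PS !andbT.
rewrite limg_dim_eq ?dS // kerg; apply/eqP; rewrite -subv0.
apply/subvP => v; rewrite memv_cap => /andP[vS /vlineP[a E1]].
rewrite memv0 E1; have [->|a0] := eqVneq a 0; first by rewrite scale0r.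
by case/negP: QS; rewrite -(memvZ_eq S Q a0) -E1.
Qed.

Lemma sum_count_mem (P : pred {vspace 'rV[F]_m}) :
  (\sum_(E | (\dim E == k.+1) && P E) count_mem E ss = count P ss)%N.
Proof.
under eq_bigr => E _ do rewrite -sum1_count.
rewrite (exchange_big_dep xpredT) //= -sum1_count [RHS]big_mkcond /= big_seq [RHS]big_seq.
apply: eq_bigr => E Es; have [PE|PE] := boolP (P E).
  rewrite (big_pred1 E) // => E' /=; rewrite [E == E']eq_sym; have [->|_] := eqVneq E' E.
    by rewrite (ss_packs.1 E Es) eqxx PE.
  by rewrite andbF.
rewrite big_pred0 // => E' /=; have [<-|_] := eqVneq E E'; last by rewrite andbF.
by rewrite (negbTE PE) andbF.
Qed.

(* [projected_mult_le] is a termwise inequality between two sums over the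
   subspaces of a hyperplane, and the sums agree. *)
Lemma projected_mult_eq E : \dim E = k.+1 -> projected_mult E = count_mem E ss.
Proof.
move=> dE; pose T := (g @^-1: E)%VS.
have dT : \dim T = k.+2.
  by rewrite dim_preim ?(quotient_full (dim_point Q_neq0)) // kerg dim_vline Q_neq0 dE addn1.
have [|K TK dK] := @exists_supspace F m.+1 m T; first by rewrite dT km /=.
have kT v : g v = 0 -> v \in T by move=> gv; rewrite -memv_preim gv mem0v.
have QT : Q \in T.
  by apply: kT; apply/eqP; rewrite -memv_ker kerg memv_line.
have QK : Q \in K := subvP TK Q QT.
have [ssK [sK pK sKK]] := exists_hyperplane_packs Q_neq0 kerg wQ ss_size ss_packs dK QK.
have cK S dS SK := count_mult Q_neq0 kerg wQ ss_size ss_packs dK QK sK pK sKK (S := S) dS SK.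
have EK : (E <= g @: K)%VS.
  apply: subv_trans (limgS g TK); rewrite /T lpreimK //.
  by rewrite (quotient_full (dim_point Q_neq0)) ?kerg ?subvf.
have Etot : (\sum_(E' | (\dim E' == k.+1) && (E' <= g @: K)%VS) projected_mult E' =
    \sum_(E' | (\dim E' == k.+1) && (E' <= g @: K)%VS) count_mem E' ss)%N.
  rewrite sum_projected_mult sum_count_mem -sK.
  have := sum_mult_hyperplane (P := fun S => (S <= K)%VS) pK sKK cK (fun S SK => SK).
  have -> : count (fun S => (S <= K)%VS) ssK = size ssK.
    by apply/eqP; rewrite -all_count; apply/allP.
  move=> <-; apply: eq_bigl => S.
  by rewrite (image_sub Q_neq0 kerg).
apply/eqP; rewrite eqn_leq projected_mult_le //= leqNgt; apply/negP => lt.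
move: Etot; rewrite (bigD1 E) ?dE ?eqxx //= [RHS](bigD1 E) ?dE ?eqxx //= => Etot.
suff H : (projected_mult E < projected_mult E)%N by rewrite ltnn in H.
apply: leq_trans lt _; rewrite -(leq_add2r (\sum_(E' | (\dim E' == k.+1) &&
  (E' <= g @: K)%VS && (E' != E)) projected_mult E')) Etot leq_add2l.
by apply: leq_sum => E' /andP[/andP[/eqP dE' _] _]; apply: projected_mult_le.
Qed.

Lemma sum_mult : (\sum_(S | kspace S) mult S = t)%N.
Proof.
have := sum_projected_mult xpredT; under [RHS]eq_bigl => S do rewrite andbT.
move=> <-; rewrite (eq_bigr (fun E => count_mem E ss)) => [|E /andP[/eqP dE _]].
  by rewrite sum_count_mem count_predT.
exact: projected_mult_eq.
Qed.

Lemma sum_mult_through v : g v != 0 ->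
  (\sum_(S | kspace S && (v \in S)) mult S <= push g w (g v))%N.
Proof.
move=> gv; apply: leq_trans (ss_packs.2 _ gv).
rewrite -sum_count_mem -(eq_bigr _ (fun E PE => projected_mult_eq (eqP (andP PE).1))).
rewrite sum_projected_mult [X in (_ <= X)%N]big_mkcond [X in (X <= _)%N]big_mkcond /=.
apply: leq_sum => S _.
by case: (\dim S == k.+1) => //=; case: (boolP (v \in S)) => // vS; rewrite memv_img.
Qed.

End FixedCenter.

(* The projection from [Q] separates [v] from the rest of the support: [v] is the
   only point of positive weight on the line joining [Q] to [v]. *)
Lemma exists_center v : v != 0 -> exists (Q : V) (g : 'Hom(V, 'rV[F]_m)),
  [/\ Q != 0, lker g = <[Q]>%VS, w Q = 0%N, g v != 0 & (push g w (g v) <= w v)%N].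
Proof.
move=> v0; have [h kh] := exists_projection v0.
have hT := quotient_full (dim_point v0) kh.
(* The total mass is below p^(k+2) - 1 <= p^m - 1, so some line through v carries no weight besides
   that of v. *)
have [|u [u0 _ pu]] := @mass_lt_zero F m (push h w) fullv.
  rewrite dim_rV; have := mass_push h w fullv; rewrite kh => E.
  apply: leq_ltn_trans (leq_addr (mass w <[v]>%VS) _) _; rewrite E.
  apply: leq_ltn_trans (massS w (subvf _)) _.
  apply: leq_trans (zero_arith p_gt1 q_gt0 tp wS) _.
  by rewrite leq_sub2r // -!expnS leq_exp2l.
have : u \in limg h by rewrite hT memvf.
case/memv_imgP=> Q _ uQ.
have zero a x : a != 0 -> h x = a *: u -> w x = 0%N.
  move=> a0 hx; apply/eqP; rewrite -leqn0.
  have <- : push h w (a *: u) = 0%N by rewrite push_scale_inv.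
  by rewrite /push (bigD1 x) ?hx //= leq_addr.
have Q0 : Q != 0 by apply: contraNneq u0 => Q0; rewrite uQ Q0 linear0.
have wQ : w Q = 0%N by apply: (zero 1) (oner_neq0 _) _; rewrite scale1r.
have [g kg] := exists_projection Q0; exists Q, g; split=> //.
  rewrite -memv_ker kg; apply/negP => /vlineP[a va].
  have : h v == 0 by rewrite -memv_ker kh memv_line.
  rewrite va linearZ /= -uQ scaler_eq0 (negbTE u0) orbF => /eqP a0.
  by rewrite va a0 scale0r eqxx in v0.
rewrite /push (bigD1 v) //= big1 ?addn0 // => x /andP[/eqP gx xv].
have : x - v \in <[Q]>%VS by rewrite -kg memv_ker linearB /= gx subrr.
case/vlineP=> a xa; have a0 : a != 0.
  by apply: contraNneq xv => a0; rewrite -subr_eq0 xa a0 scale0r.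
apply: (zero a) => //; rewrite -(subrK v x) xa linearD linearZ /= -uQ.
have : v \in lker h by rewrite kh memv_line.
by rewrite memv_ker => /eqP ->; rewrite addr0.
Qed.

Theorem decomposes_lift : exists2 ss, size ss = t & packs k w ss.
Proof.
pose c S := if \dim S == k.+1 then mult S else 0%N.
pose ss := flatten [seq nseq (c W) W | W <- enum {: {vspace V}}].
have countE (P : pred {vspace V}) : count P ss = (\sum_(S | kspace S && P S) mult S)%N.
  rewrite count_flatten -map_comp sumnE big_map big_enum /= [RHS]big_mkcond /=.
  apply: eq_bigr => S _; rewrite count_nseq /c; case: (\dim S == k.+1); rewrite ?muln0 //=.
  by case: (P S); rewrite ?mul1n.
exists ss.
  rewrite -count_predT countE; under eq_bigl => S do rewrite andbT.
  have [|Q [Q0 _ wQ]] := @exists_zero_in fullv; first by rewrite dim_rV leqW.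
  have [g kg] := exists_projection Q0.
  have [ssQ sQ pQ] := exists_projection_packs Q0 kg wQ.
  exact: sum_mult Q0 kg wQ sQ pQ.
split=> [S|v v0].
  case/flatten_mapP=> W _; rewrite mem_nseq /c.
  by case: eqP => [dW /andP[_ /eqP ->]|].
have [Q [g [Q0 kg wQ gv le]]] := exists_center v0.
have [ssQ sQ pQ] := exists_projection_packs Q0 kg wQ.
rewrite countE; apply: leq_trans le.
exact: sum_mult_through Q0 kg wQ sQ pQ _ gv.
Qed.

End Lift.

Theorem decomposes_prime (p k m : nat) : prime p -> (0 < k)%N -> (k.+2 <= m)%N ->
  decomposes 'F_p k m.
Proof.
move=> pr_p k0 /subnK <-; elim: (m - k.+2)%N => [|d IH].
  apply: decomposes_plus2 => j t w j0 /andP[t0 tp] wi wB wS wM U dU.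
  apply: (line_mod j0 tp wi wB wS t0 _ dU) => U1 U2 d1 d2 n2 U12.
  rewrite [#|_|]card_Fp //; exact: skew_line_mod n2 U12.
by move=> t w tp wi wB wS; apply: decomposes_lift => //; apply: leq_addl.
Qed.

(** * From vectors back to points of PG(n,p) *)

Section Translation.

Variables (F : finFieldType) (n : nat) (B : weighted_set F n).
Local Notation V := 'rV[F]_n.+1.

(** The default 0 is taken only at the zero vector, whose span is not a point. *)
Definition vector_weight (v : V) : nat :=
  if insub <[v]>%VS is Some P then B P else 0%N.

Lemma vector_weight_inv : scale_inv vector_weight.
Proof.
move=> a v a0; rewrite /vector_weight; congr (if insub _ is Some P then B P else 0%N).
have [->|v0] := eqVneq v 0; first by rewrite scaler0.
apply/eqP; rewrite eqEdim -memvE memvZ ?memv_line // !dim_vline.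
by rewrite scaler_eq0 (negbTE a0) (negbTE v0).
Qed.

Lemma point_pick (P : point F n) : isrep (vpick (val P)) /\ <[vpick (val P)]>%VS = val P.
Proof.
have dP : \dim (val P) = 1%N by case: P => U /= /eqP.
have v0 : vpick (val P) != 0 by rewrite vpick0 -dimv_eq0 dP.
have E : <[vpick (val P)]>%VS = val P.
  by apply/eqP; rewrite eqEdim -memvE memv_pick dim_vline v0 dP.
by rewrite /isrep v0 E eqxx.
Qed.

Lemma vector_weight_pick (P : point F n) : vector_weight (vpick (val P)) = B P.
Proof. by rewrite /vector_weight (point_pick P).2 valK. Qed.

Lemma pts_wcap (U : {vspace V}) : pts vector_weight U = wcap U B.
Proof.
rewrite /pts /wcap (reindex_omap (fun P : point F n => vpick (val P))
  (fun v => insub <[v]>%VS)) /=; last first.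
  move=> v /andP[/andP[v0 /eqP vv] _]; have dv : \dim <[v]>%VS == 1%N by rewrite dim_vline v0.
  by rewrite insubT /= vv.
apply: eq_big => [P|P _]; last exact: vector_weight_pick.
have [-> E] := point_pick P; rewrite E valK eqxx andbT /= /on_subspace.
by rewrite memvE E.
Qed.

End Translation.

Lemma size_bound_nat (s t a : nat) :
  s%:R <= (t%:R + 2%:R^-1) * a%:R - 2%:R^-1 :> rat -> (2 * s + 1 <= (2 * t + 1) * a)%N.
Proof.
move=> H; rewrite -(ler_nat rat) natrD !natrM natrD natrM.
lra.
Qed.

Lemma fold_bound_nat (t p : nat) : (1 < p)%N ->
  t%:R <= 3%:R / 8%:R * p%:R + 1 :> rat -> (t < p)%N.
Proof.
(* For p >= 2 we have 3p + 8 < 8p. *)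
move=> p1 H; have : (8 * t <= 3 * p + 8)%N.
  by rewrite -(ler_nat rat) natrD !natrM; lra.
by lia.
Qed.

Lemma dim_cap_lower (F : fieldType) (n k : nat) (U S : {vspace 'rV[F]_n.+1}) :
  (\dim U + k = n.+1)%N -> \dim S = k.+1 -> (0 < \dim (U :&: S))%N.
Proof.
move=> dU dS; have := dimv_sum_cap U S; rewrite dS.
have := dimvS (subvf (U + S)); rewrite dimvf /dim /= mul1n.
by move: (\dim (U + S)) (\dim (U :&: S)) dU => a b; move: (\dim U) => c; lia.
Qed.

Lemma union_blocking (F : finFieldType) (n k t : nat) (S : 'I_t -> {vspace 'rV[F]_n.+1}) :
  (k <= n)%N -> (forall i, has_pdim k (S i)) ->
  blocking_set t k (fun P : point F n => #|[set i | on_subspace (S i) P]|).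
Proof.
move=> kn dS U /eqP dU; rewrite /wcap.
have dUk : (\dim U + k = n.+1)%N by rewrite dU addSn subnK.
have meet i : exists P : point F n, on_subspace U P && on_subspace (S i) P.
  have := dim_cap_lower dUk (eqP (dS i)); rewrite lt0n dimv_eq0 -vpick0 => v0.
  have dv : \dim <[vpick (U :&: S i)]>%VS == 1%N by rewrite dim_vline v0.
  exists (exist _ <[vpick (U :&: S i)]>%VS dv); rewrite /on_subspace /= -!memvE.
  by have := memv_pick (U :&: S i); rewrite memv_cap.
rewrite (eq_bigr (fun P => \sum_(i < t) (on_subspace (S i) P))%N); last first.
  by move=> P _; rewrite -sum1_card big_mkcond; apply: eq_bigr => i _; rewrite inE; case: ifP.
rewrite exchange_big -[X in (X <= _)%N](card_ord t) -sum1_card; apply: leq_sum => i _.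
have [P /andP[UP SP]] := meet i.
by rewrite (bigD1 P) //= SP.
Qed.

Theorem theorem1p9 (p n k t : nat) (B : weighted_set 'F_p n)
    (p_prime : prime p) (n_ge2 : (2 <= n)%N) (k_bounds : (1 <= k <= n - 1)%N)
    (t_ge1 : (1 <= t)%N)
    (t_le : t%:R <= 3%:R / 8%:R * p%:R + 1 :> rat)
    (B_minimal : minimal_blocking_set t k B)
    (B_size : (wsize B)%:R <= (t%:R + 2%:R^-1) * p%:R ^+ k - 2%:R^-1 :> rat) :
  exists S : 'I_t -> {vspace 'rV['F_p]_n.+1},
    (forall i : 'I_t, has_pdim k (S i)) /\ weighted_union S B.
Proof.
have [k0 kn1] := andP k_bounds; have kn : (k <= n)%N by lia.
have cF : #|'F_p| = p by rewrite card_Fp.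
have tp : (t < #|'F_p|)%N by rewrite cF; apply: fold_bound_nat t_le; apply: prime_gt1.
have [blockB minB] := B_minimal.
pose w := vector_weight B; have wi : scale_inv w := vector_weight_inv B.
have sizeB : pts w fullv = wsize B.
  by rewrite pts_wcap /wcap /wsize; apply: eq_bigl => P; rewrite /on_subspace subvf.
have wB : blocks k t w.
  move=> U dU; rewrite pts_mass // mulnC leq_mul2l pts_wcap blockB ?orbT //.
  by rewrite /has_pdim -(eqn_add2r k) dU addSn subnK.
have wS : small k t w.
  rewrite /small pts_mass // mulnCA leq_mul2l sizeB cF; apply/orP; right.
  have : (2 * wsize B + 1 <= (2 * t + 1) * p ^ k)%N by apply: size_bound_nat; rewrite natrX.
  by move: ((2 * t + 1) * p ^ k)%N (wsize B) => a b; lia.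
have km : (k.+2 <= n.+1)%N by lia.
have [ss sss [dss css]] := decomposes_prime p_prime k0 km tp wi wB wS.
pose S (i : 'I_t) := nth 0%VS ss i.
have dS i : has_pdim k (S i) by apply/eqP/dss/mem_nth; rewrite sss.
exists S; split=> // P; apply/eqP; rewrite eq_sym eqn_leq.
have le Q : (#|[set i : 'I_t | on_subspace (S i) Q]| <= B Q)%N.
  have [vr vE] := point_pick Q; rewrite -(vector_weight_pick B Q).
  apply: leq_trans (css _ (andP vr).1); rewrite -sum1_card -sum1_count.
  rewrite (big_nth 0%VS) big_mkord sss big_mkcond [X in (_ <= X)%N]big_mkcond.
  by apply: leq_sum => i _; rewrite inE /on_subspace -[X in (X <= _)%VS]vE -memvE.
rewrite le /= leqNgt; apply/negP => lt.
(* Lowering only the weight of P, down to the number of chosen subspaces through P, keeps the weight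
   above their union, which is itself a t-fold blocking set. *)
apply: (minB P (fun Q => if Q == P then #|[set i | on_subspace (S i) P]| else B Q)).
- by rewrite eqxx.
- by move=> Q /negbTE ->.
move=> U dU; apply: leq_trans (union_blocking kn dS dU) _; apply: leq_sum => Q _.
by case: eqP => [->|].
Qed.
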